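(* Let $F$ be a differentiable piecewise cubic function on $I=[a,b]$. Then the bridge intervals produced by the algorithm described in the context are precisely the component intervals of $Z_F^c$.
   Context: $I=[a,b]$ is a compact interval. ''Differentiable piecewise cubic'' means: $F$ is differentiable on $I$ (one-sided at the endpoints) and there is a finite partition of $I$ on each closed subinterval of which $F$ is a polynomial of degree at most three. The least concave majorant of $F$ is $\hat F(x)=\inf\{G(x): G\ge F \text{ on } I,\ G \text{ concave}\}$, $x\in I$. $Z_F=\{x\in I:\hat F(x)=F(x)\}$ and $Z_F^c=I\setminus Z_F$; its connected components are called component intervals. $M=\max_I F$, $D=\{x\in I:F(x)=M\}$, and $C=[c_1,c_2]$ is the smallest closed interval containing $D$. Bridge interval: an interval $(\alpha,\beta)$ with $a\le\alpha<\beta\le b$ such that (i) $F(x)<F(\alpha)+(x-\alpha)\frac{F(\beta)-F(\alpha)}{\beta-\alpha}$ for $\alpha<x<\beta$, and (ii) $F'(\alpha)=\frac{F(\beta)-F(\alpha)}{\beta-\alpha}=F'(\beta)$, where the equality involving $F'(\alpha)$ is omitted if $\alpha=a$ and the equality involving $F'(\beta)$ is omitted if $\beta=b$. Algorithm. (A) Middle part: output the connected components of $C\setminus D$. (B) Left part (nothing is done if $a=c_1$). Let $P$ be the finite collection of closed intervals determined by the partition of $[a,c_1]$ inherited from the piecewise cubic structure of $F$, refined by adding critical points and points of inflection of $F$, so that on each interval of $P$ the function $F$ is strictly concave, linear or strictly convex, and is monotone. Let $\mathcal P_0=\mathcal P$ be the collection of those intervals in $P$ on which $F$ is strictly concave and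 (strictly) increasing. (B0) Only if $c_1=c_2=b$: first look for a bridge interval of the form $(r,b)$, testing first $r=a$ and then $r$ in the intervals of $\mathcal P_0$, from the leftmost to the rightmost, stopping at the first one found. If one is found, output it and update $\mathcal P_0$ by the truncation rule below with $w_1=r$. (B1) Iteration $n=0,1,2,\dots$, as long as $\mathcal P_n\ne\emptyset$: let $R$ be the interval in $\mathcal P_n$ closest to $c_1$. First test whether there is a bridge interval $(a,r)$ with $r\in R$. If not, go through the intervals $L\in\mathcal P_n$ lying to the left of $R$, from the one closest to $a$ moving systematically to the right, testing each for the existence of a bridge interval $(w_1,w_2)$ with $w_1\in L$, $w_2\in R$, and stop at the first $L$ for which there is one. If no bridge interval is found in this way, set $\mathcal P_{n+1}=\mathcal P_n\setminus\{R\}$. If a bridge interval $(w_1,w_2)$ is found (with $w_1=a$ in the first test), output it and form $\mathcal P_{n+1}$ from $\mathcal P_n$ by the truncation rule. Truncation rule: discard all intervals lying to the right of $w_1$, and replace the interval $N=[n_1,n_2]$ containing $w_1$ (if any) by $[n_1,w_1]$ if $n_1<w_1$, and discard $N$ otherwise. (If $w_1=a$ everything is discarded.) The procedure stops when the current collection is empty. (C) Right part (nothing is done if $c_2=b$): proceed analogously on $[c_2,b]$, i.e. apply (B) to the reflected function $x\mapsto F(a+b-x)$ and reflect the output. *)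

(* Defs.v *)
(* MathComp-Analysis *)
From HB Require Import structures.
From mathcomp Require Import all_boot all_order all_algebra.
From mathcomp Require Import all_classical all_reals all_analysis.
Import Order.TTheory GRing.Theory Num.Theory.
Import numFieldNormedType.Exports.

Set Implicit Arguments.
Unset Strict Implicit.
Unset Printing Implicit Defensive.

Local Open Scope classical_set_scope.
Local Open Scope ring_scope.

Section Defs.
Context {R : realType}.
Implicit Types (a b c x y : R) (F G : R -> R) (J K L N : R * R)
  (s nodes : seq R) (A B : set R).

Definition differentiable_on_itv a b F : Prop :=
  [/\ {in `]a, b[, forall x, derivable F x 1},
      cvg ((fun h => h^-1 * (F (a + h) - F a)) @ 0^'+)
    & cvg ((fun h => h^-1 * (F (b + h) - F b)) @ 0^'-)].

(* The closed intervals [x_i, x_{i+1}] of the partition a = x_0 < x_1 < ...,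
   where s = [:: x_1; x_2; ...], from left to right.  A closed interval is
   encoded by the pair of its endpoints. *)
Definition pieces a s : seq (R * R) := zip (a :: s) s.

Definition cubic_partition a b F s : Prop :=
  itv_partition a b s /\
  forall J, J \in pieces a s ->
    exists2 p : {poly R}, (size p <= 4)%N & {in `[J.1, J.2], F =1 horner p}.

Definition concave_on A G : Prop :=
  convex_function (A : set (convex_lmodType R^o)) (fun x => - G x : R^o).

Definition least_concave_majorant a b F x : R :=
  inf [set G x | G in [set G : R -> R |
    concave_on `[a, b] G /\ {in `[a, b], forall y, F y <= G y}]].

Definition contact_set a b F : set R :=
  [set x | x \in `[a, b] /\ least_concave_majorant a b F x = F x].

Definition noncontact_set a b F : set R := `[a, b] `\` contact_set a b F.

Definition components A : set (set R) :=
  [set connected_component A x | x in A].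

Definition max_on a b F : R := sup [set F x | x in `[a, b]].

Definition argmax_set a b F : set R :=
  [set x | x \in `[a, b] /\ F x = max_on a b F].

(* argmax_set a b F is compact and nonempty for the functions F considered here,
   so the smallest closed interval containing it is [cmin a b F, cmax a b F]. *)
Definition cmin a b F : R := inf (argmax_set a b F).
Definition cmax a b F : R := sup (argmax_set a b F).

Definition slope F x y : R := (F y - F x) / (y - x).

(* When a < x (resp. y < b) the point x (resp. y) is interior to [a, b]. *)
Definition bridge a b F x y : Prop :=
  [/\ [/\ a <= x, x < y & y <= b],
      {in `]x, y[, forall z, F z < F x + (z - x) * slope F x y},
      (a < x -> derive1 F x = slope F x y)
    & (y < b -> derive1 F y = slope F x y)].

Definition strictly_convex_on J F : Prop :=
  forall x y t, x \in `[J.1, J.2] -> y \in `[J.1, J.2] -> x != y ->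
    0 < t -> t < 1 ->
    F (t * x + (1 - t) * y) < t * F x + (1 - t) * F y.

Definition strictly_concave_on J F : Prop :=
  strictly_convex_on J (fun x => - F x).

Definition linear_on J F : Prop :=
  exists k m : R, {in `[J.1, J.2], forall x, F x = k * x + m}.

Definition strictly_increasing_on J F : Prop :=
  {in `[J.1, J.2] &, {homo F : x y / x < y}}.

Definition monotone_on J F : Prop :=
  {in `[J.1, J.2] &, {homo F : x y / x <= y}} \/
  {in `[J.1, J.2] &, {homo F : x y / x <= y >-> x >= y}}.

Definition critical_point F x : Prop := derive1 F x = 0.

Definition inflection_point F x : Prop :=
  exists2 e : R, 0 < e &
    (strictly_convex_on (x - e, x) F /\ strictly_concave_on (x, x + e) F) \/
    (strictly_concave_on (x - e, x) F /\ strictly_convex_on (x, x + e) F).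

(* s subdivides [a, cmin a b F]; besides its right end, its points are the given
   nodes together with finitely many critical points and points of inflection,
   enough of them for the last condition to hold (which forces every isolated
   critical point and every point of inflection to be included).  Not all
   critical points can be included: where F is constant every point is critical. *)
Definition refined_partition a b F nodes s : Prop :=
  let c1 := cmin a b F in
  [/\ itv_partition a c1 s,
      {in nodes, forall x, a < x -> x < c1 -> x \in s},
      {in s, forall x, [\/ x = c1, x \in nodes, critical_point F x
                         | inflection_point F x]}
    & forall J, J \in pieces a s ->
        [\/ strictly_concave_on J F, linear_on J F | strictly_convex_on J F] /\
        monotone_on J F].

Definition concave_increasing_pieces a F s : seq (R * R) :=
  [seq J <- pieces a s |
    `[< strictly_concave_on J F /\ strictly_increasing_on J F >]].

Definition bridge_between a b F L J (w : R * R) : Prop :=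
  [/\ w.1 \in `[L.1, L.2], w.2 \in `[J.1, J.2] & bridge a b F w.1 w.2].

(* w is a bridge interval from the first interval L of the list Ls from which
   there is a bridge interval ending in J. *)
Definition first_bridge a b F (Ls : seq (R * R)) J w : Prop :=
  exists Ls1 L Ls2,
    [/\ Ls = Ls1 ++ L :: Ls2,
        {in Ls1, forall K w', ~ bridge_between a b F K J w'}
      & bridge_between a b F L J w].

Definition no_bridge a b F (Ls : seq (R * R)) J : Prop :=
  {in Ls, forall L w, ~ bridge_between a b F L J w}.

Definition truncate x (Ps : seq (R * R)) : seq (R * R) :=
  [seq (N.1, Num.min N.2 x) | N <- Ps & N.1 < x].

(* Lists of intervals are ordered from left to right, so in rcons Ls J the
   interval J is the one closest to c_1 and Ls lists those to its left.
   The degenerate interval (a, a) at the head of the list of candidates stands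
   for the preliminary test of the left endpoint a. *)
Inductive left_loop a b F : seq (R * R) -> seq (R * R) -> Prop :=
| LoopStop : left_loop a b F [::] [::]
| LoopFail Ls J out :
    no_bridge a b F ((a, a) :: Ls) J ->
    left_loop a b F Ls out ->
    left_loop a b F (rcons Ls J) out
| LoopFound Ls J w out :
    first_bridge a b F ((a, a) :: Ls) J w ->
    left_loop a b F (truncate w.1 (rcons Ls J)) out ->
    left_loop a b F (rcons Ls J) (w :: out).

(* left_part a b F nodes out: the treatment of [a, c_1] may output the list out
   of bridge intervals. *)
Inductive left_part a b F nodes : seq (R * R) -> Prop :=
| LeftNone : cmin a b F = a -> left_part a b F nodes [::]
| LeftPlain s out :
    a < cmin a b F ->
    ~ (cmin a b F = cmax a b F /\ cmax a b F = b) ->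
    refined_partition a b F nodes s ->
    left_loop a b F (concave_increasing_pieces a F s) out ->
    left_part a b F nodes out
| LeftEndFail s out :
    a < cmin a b F ->
    cmin a b F = cmax a b F /\ cmax a b F = b ->
    refined_partition a b F nodes s ->
    no_bridge a b F ((a, a) :: concave_increasing_pieces a F s) (b, b) ->
    left_loop a b F (concave_increasing_pieces a F s) out ->
    left_part a b F nodes out
| LeftEndFound s w out :
    a < cmin a b F ->
    cmin a b F = cmax a b F /\ cmax a b F = b ->
    refined_partition a b F nodes s ->
    first_bridge a b F ((a, a) :: concave_increasing_pieces a F s) (b, b) w ->
    left_loop a b F (truncate w.1 (concave_increasing_pieces a F s)) out ->
    left_part a b F nodes (w :: out).

Definition reflect a b x : R := a + b - x.

Definition open_itvs (out : seq (R * R)) : set (set R) :=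
  [set `]w.1, w.2[%classic | w in [set` out]].

(* The algorithm, run on F with the partition s of [a, b] into pieces on which F
   is a cubic polynomial, may output the collection of intervals out. *)
Definition algorithm_output a b F s (out : set (set R)) : Prop :=
  exists outl outr : seq (R * R),
    [/\ left_part a b F (a :: s) outl,
        left_part a b (F \o reflect a b) (map (reflect a b) (a :: s)) outr
      & out =
        components (`[cmin a b F, cmax a b F] `\` argmax_set a b F) `|`
        open_itvs outl `|`
        open_itvs [seq (reflect a b w.2, reflect a b w.1) | w <- outr]].

End Defs.

(* Main.v *)
Require Import Defs.
From mathcomp Require Import all_boot all_order all_algebra.
From mathcomp Require Import all_classical all_reals all_analysis.
From mathcomp Require Import ring lra polyorder polyrcf.
Import Order.TTheory GRing.Theory Num.Theory.
Import numFieldNormedType.Exports.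
Local Open Scope classical_set_scope.
Local Open Scope ring_scope.

Set Implicit Arguments.
Unset Strict Implicit.

(** Write contact point for a point of [a, b] where F meets its least concave
majorant.  A point is a contact point exactly when F is there at least as large
as every chord of F that passes over it ([contact_setP]).  The noncontact set is
therefore relatively open and its components are the gaps: the open intervals
between two contact points that contain none.  Over a gap the majorant is the
chord of F, by a maximum principle for the excess of F over that chord; so the
line through the ends of a gap majorises F on [a, b] and touches it only at
contact points ([gap_chord]).  Hence every gap is a bridge interval, and a bridge
interval is a gap as soon as its line majorises F.

A bridge interval need not be a gap, and the heart of the proof is that the order
of the searches excludes the other ones ([first_bridge_gap]).  Let (w1, w2) be
the bridge found from the leftmost possible piece to the piece J.  If its line l
does not majorise F, then an end of the bridge lies inside a gap (v1, v2) whose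
right end lies in J, and comparing l with the line l' of the gap shows that
v1 < w1 and l < l' at v1.  Minimality of the search puts v1 in the same piece L as
w1; but F is concave on L and tangent to l at w1, so that
F(v1) <= l(v1) < l'(v1) = F(v1), a contradiction.

The rest is bookkeeping.  To the left of the first maximiser c1 the line of a gap
has positive slope, so just inside its ends F is strictly concave and increasing: the
ends of the gaps lie in the pieces kept by the algorithm, apart from the ends a
and b themselves.  Along the loop each gap is either pending, with both its ends
in the current pieces, or cleared, to the right of all of them ([tracked]); the
loop outputs the gaps that are pending at its start ([left_loop_gaps]).  Between
the first and the last maximiser the contact points are the maximisers, and the
right part follows from the left part by reflection.

A run of the algorithm exists because on each cubic piece the zeros of the first
two derivatives cut out finitely many intervals of constant shape, and because
each iteration of the loop shortens the list of pieces. *)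

(** * One-sided bounds on a derivative *)

Section DerivativeEstimates.
Context {R : realType}.
Implicit Types (F : R -> R) (x y k d e : R).

Lemma derivable_approx F x e : derivable F x 1 -> 0 < e ->
  exists2 d, 0 < d & forall y, `|y - x| < d ->
    `|F y - F x - derive1 F x * (y - x)| <= e * `|y - x|.
Proof.
move=> dF e0; rewrite derive1E.
have /cvgrPdist_le/(_ _ e0) := dF.
move=> /nbhs_ballP[d /= d0 Hd]; exists d => // y yx.
have [->|yx0] := eqVneq y x; first by rewrite !subrr mulr0 subr0 normr0 mulr0.
have h0 : y - x != 0 by rewrite subr_eq0.
have := Hd (y - x); rewrite /ball /= sub0r normrN => /(_ yx h0).
rewrite scaler1 subrK => H.
have -> : F y - F x - 'D_1 F x * (y - x) =
    - (('D_1 F x - (y - x)^-1 *: (F y - F x)) * (y - x)).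
  by rewrite mulrBl [_ *: _]mulrC mulfVK// opprB.
by rewrite normrN normrM ler_wpM2r.
Qed.

(** At an end of a bridge or of a piece only one side is known, but F is
differentiable there from both sides: one-sided comparison with a line is enough
to bound the derivative.  The next lemmas are the four variants of this. *)
Lemma derive1_le_right F x k e : derivable F x 1 -> 0 < e ->
  (forall y, x < y -> y < x + e -> F y <= F x + k * (y - x)) ->
  derive1 F x <= k.
Proof.
move=> dF e0 H; rewrite leNgt; apply/negP => kF.
have [|d d0 Hd] := derivable_approx dF (e := (derive1 F x - k) / 2); first lra.
have [h [h0 hd he]] : exists h, [/\ 0 < h, h < d & h < e].
  by exists (Num.min d e / 2); rewrite /Num.min; case: ifP => ?; split; lra.
have := H (x + h); have := Hd (x + h); rewrite addrAC subrr add0r gtr0_norm//.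
move=> /(_ hd); rewrite ler_norml => /andP[H1 _] H2.
have {}H2 : F (x + h) <= F x + k * h by apply: H2; lra.
nra.
Qed.

Lemma derive1_ge_left F x k e : derivable F x 1 -> 0 < e ->
  (forall y, x - e < y -> y < x -> F y <= F x + k * (y - x)) ->
  k <= derive1 F x.
Proof.
move=> dF e0 H; rewrite leNgt; apply/negP => kF.
have [|d d0 Hd] := derivable_approx dF (e := (k - derive1 F x) / 2); first lra.
have [h [h0 hd he]] : exists h, [/\ 0 < h, h < d & h < e].
  by exists (Num.min d e / 2); rewrite /Num.min; case: ifP => ?; split; lra.
have := H (x - h); have := Hd (x - h).
rewrite [x - h - x]addrAC subrr add0r normrN gtr0_norm//.
move=> /(_ hd); rewrite ler_norml => /andP[H1 _] H2.
have {}H2 : F (x - h) <= F x + k * (- h) by apply: H2; lra.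
nra.
Qed.

Lemma derivableN1 F x : derivable F x 1 ->
  derivable (fun y => - F y) x 1 /\ derive1 (fun y => - F y) x = - derive1 F x.
Proof.
move=> dF; split; first exact: derivableN.
by rewrite !derive1E (_ : (fun y => - F y) = - F)// deriveN.
Qed.

Lemma derive1_ge_right F x k e : derivable F x 1 -> 0 < e ->
  (forall y, x < y -> y < x + e -> F x + k * (y - x) <= F y) ->
  k <= derive1 F x.
Proof.
move=> /derivableN1[dF dE] e0 H; rewrite -lerN2 -dE.
by apply: derive1_le_right dF e0 _ => y xy ye; have := H _ xy ye; lra.
Qed.

Lemma derive1_le_left F x k e : derivable F x 1 -> 0 < e ->
  (forall y, x - e < y -> y < x -> F x + k * (y - x) <= F y) ->
  derive1 F x <= k.
Proof.
move=> /derivableN1[dF dE] e0 H; rewrite -lerN2 -dE.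
by apply: derive1_ge_left dF e0 _ => y xy ye; have := H _ xy ye; lra.
Qed.

End DerivativeEstimates.

(** * Regularity up to the ends of the interval *)

Section Regularity.
Context {R : realType}.
Implicit Types (F : R -> R) (a b x y k d e K : R).

(** Unlike the two-sided derivative of F at a and b, these conditions only see F
on [a, b]; they are also invariant under reflection. *)
Definition regular a b F : Prop :=
  {in `]a, b[, forall x, derivable F x 1} /\
  exists K d, [/\ 0 < d,
    forall y, a <= y -> y <= b -> y < a + d -> `|F y - F a| <= K * (y - a) &
    forall y, a <= y -> y <= b -> b - d < y -> `|F y - F b| <= K * (b - y)].

Lemma differentiable_on_itv_regular a b F :
  differentiable_on_itv a b F -> regular a b F.
Proof.
move=> [dF /cvg_ex[l /= Fa] /cvg_ex[m /= Fb]]; split=> //.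
move/cvgrPdist_le : Fa => /(_ _ ltr01)/nbhs_ballP[d /= d0 Hd].
move/cvgrPdist_le : Fb => /(_ _ ltr01)/nbhs_ballP[e /= e0 He].
exists (Num.max `|l| `|m| + 1), (Num.min d e); split.
- by rewrite lt_min d0.
- move=> y; rewrite le_eqVlt => /predU1P[<- _ _|ay yb].
    by rewrite !subrr mulr0 normr0.
  rewrite -ltrBlDl lt_min => /andP[yd _].
  have ya0 : 0 < y - a by lra.
  have := Hd (y - a); rewrite /ball /= sub0r normrN gtr0_norm//.
  move=> /(_ yd ya0); rewrite [a + _]addrC subrK => H.
  rewrite -ler_pdivrMr// -[X in _ / X]gtr0_norm// -normfV -normrM mulrC.
  have := ler_distD l 0 ((y - a)^-1 * (F y - F a)).
  rewrite !sub0r !normrN => H2; rewrite (le_trans H2)// lerD//.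
  by rewrite le_max lexx.
- move=> y ay; rewrite le_eqVlt => /predU1P[-> _|yb].
    by rewrite !subrr mulr0 normr0.
  rewrite ltrBlDr -ltrBlDl lt_min => /andP[_ yd].
  have ya0 : 0 < b - y by lra.
  have ya1 : y - b < 0 by lra.
  have := He (y - b); rewrite /ball /= sub0r normrN ltr0_norm// opprB.
  move=> /(_ yd ya1); rewrite [b + _]addrC subrK => H.
  rewrite -ler_pdivrMr// -(opprB y b) -[X in _ / X]ltr0_norm// -normfV -normrM mulrC.
  have := ler_distD m 0 ((y - b)^-1 * (F y - F b)).
  rewrite !sub0r !normrN => H2; rewrite (le_trans H2)// lerD//.
  by rewrite le_max lexx orbT.
Qed.

Lemma regular_reflect a b F : regular a b F -> regular a b (F \o Defs.reflect a b).
Proof.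
move=> [dF [K [d [d0 Fa Fb]]]]; split; last first.
  exists K, d; split=> // y ay yb yd; rewrite /= /Defs.reflect.
  - have -> : a + b - a = b by lra.
    have -> : y - a = b - (a + b - y) by lra.
    by apply: Fb; lra.
  - have -> : a + b - b = a by lra.
    have -> : b - y = (a + b - y) - a by lra.
    by apply: Fa; lra.
move=> x; rewrite in_itv /= => /andP[ax xb].
apply/derivable1_diffP; apply: differentiable_comp.
  by apply/derivable1_diffP; rewrite /Defs.reflect; apply: derivableB.
by apply/derivable1_diffP; apply: dF; rewrite in_itv /= /Defs.reflect; lra.
Qed.

Lemma regular_continuous a b F x e : regular a b F -> a <= x -> x <= b ->
  0 < e -> exists2 d, 0 < d &
    forall y, a <= y -> y <= b -> `|y - x| < d -> `|F y - F x| < e.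
Proof.
move=> [dF [K [d [d0 Fa Fb]]]] ax xb e0.
(* a Lipschitz bound near x suffices *)
suff [L [r [L0 r0 H]]] : exists L r, [/\ 0 < L, 0 < r & forall y,
    a <= y -> y <= b -> `|y - x| < r -> `|F y - F x| <= L * `|y - x|].
  exists (Num.min r (e / L)).
    by rewrite lt_min r0 divr_gt0.
  move=> y ay yb; rewrite lt_min => /andP[yr ye].
  rewrite (le_lt_trans (H _ ay yb yr))//.
  by rewrite mulrC -ltr_pdivlMr.
have [xa|xa] := eqVneq x a; [|have [xb'|xb'] := eqVneq x b].
- exists (`|K| + 1), d; split=> //.
  rewrite xa => y ay yb; rewrite ger0_norm ?subr_ge0// => yd.
  rewrite (le_trans (Fa _ ay yb _))//; first lra.
  by rewrite ler_wpM2r ?subr_ge0// (le_trans (ler_norm _))// lerDl.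
- exists (`|K| + 1), d; split=> //.
  rewrite xb' => y ay yb; rewrite distrC ger0_norm ?subr_ge0// => yd.
  rewrite (le_trans (Fb _ ay yb _))//; first lra.
  by rewrite ler_wpM2r ?subr_ge0// (le_trans (ler_norm _))// lerDl.
- have /derivable_approx/(_ ltr01)[r r0 H] : derivable F x 1.
    by apply: dF; rewrite in_itv /= !lt_neqAle ax xb xb' eq_sym xa.
  exists (`|derive1 F x| + 1), r; split=> //.
  move=> y ay yb yr; have {}H := H y yr.
  have -> : F y - F x = (F y - F x - derive1 F x * (y - x)) + derive1 F x * (y - x) by ring.
  by rewrite (le_trans (ler_normD _ _))// normrM mulrDl addrC lerD.
Qed.

(** Tilting F turns statements about a chord into statements about a maximum. *)
Lemma regular_subl a b F k : regular a b F -> regular a b (fun y => F y - k * y).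
Proof.
move=> [dF [K [d [d0 Fa Fb]]]]; split.
  move=> x xab; apply: derivableB; first exact: dF.
  exact: derivableM.
exists (K + `|k|), d; split=> // y ay yb yd.
- have -> : F y - k * y - (F a - k * a) = F y - F a - k * (y - a) by lra.
  rewrite (le_trans (ler_normB _ _))// mulrDl lerD ?Fa//.
  by rewrite normrM (ger0_norm (x := y - a))// subr_ge0.
- have -> : F y - k * y - (F b - k * b) = F y - F b - k * (y - b) by lra.
  rewrite (le_trans (ler_normB _ _))// mulrDl lerD ?Fb//.
  by rewrite normrM distrC (ger0_norm (x := b - y))// subr_ge0.
Qed.

Lemma regular_has_max a b F u v : regular a b F -> a <= u -> u <= v -> v <= b ->
  exists m, [/\ u <= m, m <= v & forall y, u <= y -> y <= v -> F y <= F m].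
Proof.
move=> rF au uv vb.
have [|m] := @EVT_max R F u v uv.
  apply/subspace_continuousP => x /=; rewrite in_itv /= => /andP[ux xv].
  apply/cvgrPdist_lt => e e0.
  have [|| d d0 H] := @regular_continuous a b F x e rF _ _ e0; [lra..|].
  rewrite near_withinE; apply/nbhs_ballP; exists d => //= y.
  rewrite /ball /= in_itv /= => xy /andP[uy yv].
  by rewrite distrC H// 1?distrC//; lra.
rewrite in_itv /= => /andP[um mv] H; exists m; split=> // y uy yv.
by apply: H; rewrite in_itv /= uy.
Qed.

End Regularity.

(** * Contact points and chords *)

Section Contact.
Context {R : realType}.
Implicit Types (F G : R -> R) (a b x y z k d e : R) (w : R * R).

(** The division-free form of the condition that F is at least as large at x as
each of its chords over x.  At the points x of [a, b] it characterises contact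
with the least concave majorant; required of all x, it says that F is concave on
[a, b].  At a and b it holds trivially. *)
Definition above_chords a b F x : Prop := forall y z,
  a <= y -> y < x -> x < z -> z <= b ->
  F y * (z - x) + F z * (x - y) <= F x * (z - y).

Lemma above_chords_of_line a b F x k :
  (forall y, a <= y -> y <= b -> F y <= F x + k * (y - x)) ->
  above_chords a b F x.
Proof.
move=> H y z ay yx xz zb.
have := H y ay; have := H z; move=> /(_ _ zb) Hz /(_ _) Hy.
have {}Hz : F z <= F x + k * (z - x) by apply: Hz; lra.
have {}Hy : F y <= F x + k * (y - x) by apply: Hy; lra.
nra.
Qed.

(** A chord from x to y on one side bounds the difference quotients of F at x
taken on the other side, hence the derivative. *)
Lemma above_chords_tangent a b F x : derivable F x 1 -> a < x -> x < b ->
  above_chords a b F x ->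
  forall y, a <= y -> y <= b -> F y <= F x + derive1 F x * (y - x).
Proof.
move=> dF ax xb H y ay yb.
have [yx|xy|<-] := ltgtP y x; last by rewrite subrr mulr0 addr0.
- have yx0 : x - y != 0 by rewrite subr_eq0 gt_eqF.
  pose k := (F x - F y) / (x - y).
  have kE : F x - F y = k * (x - y) by rewrite mulfVK.
  suff : derive1 F x <= k by nra.
  apply: (derive1_le_right dF (e := b - x)); first lra.
  move=> z xz zb; have := H _ _ ay yx xz; move=> /(_ _) H1.
  have {}H1 : F y * (z - x) + F z * (x - y) <= F x * (z - y) by apply: H1; lra.
  have : (F z - (F x + k * (z - x))) * (x - y) <= 0.
    have Fy : F y = F x - k * (x - y) by lra.
    by move: H1; rewrite Fy; nra.
  by rewrite pmulr_lle0 ?subr_gt0// subr_le0.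
- have yx0 : y - x != 0 by rewrite subr_eq0 gt_eqF.
  pose k := (F y - F x) / (y - x).
  have kE : F y - F x = k * (y - x) by rewrite mulfVK.
  suff : k <= derive1 F x by nra.
  apply: (derive1_ge_left dF (e := x - a)); first lra.
  move=> z az zx; have := H z y; move=> /(_ _ zx xy yb) H1.
  have {}H1 : F z * (y - x) + F y * (x - z) <= F x * (y - z) by apply: H1; lra.
  have : (F z - (F x + k * (z - x))) * (y - x) <= 0 by nra.
  by rewrite pmulr_lle0 ?subr_gt0// subr_le0.
Qed.

Lemma above_chords_reflect a b F x :
  above_chords a b F x -> above_chords a b (F \o Defs.reflect a b) (a + b - x).
Proof.
move=> H y z ay yx xz zb; rewrite /= /Defs.reflect.
have := H (a + b - z) (a + b - y).
have -> : a + b - (a + b - x) = x by lra.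
move=> /(_ _ _ _ _) H1.
have {}H1 : F (a + b - z) * (a + b - y - x) + F (a + b - y) * (x - (a + b - z)) <=
   F x * (a + b - y - (a + b - z)) by apply: H1; lra.
nra.
Qed.

Lemma reflectK a b x : Defs.reflect a b (Defs.reflect a b x) = x.
Proof. by rewrite /Defs.reflect; lra. Qed.

Lemma comp_reflectK a b F : (F \o Defs.reflect a b) \o Defs.reflect a b = F.
Proof. by apply/funext => x /=; rewrite reflectK. Qed.

Lemma above_chords_reflectP a b F x :
  above_chords a b (F \o Defs.reflect a b) x <->
  above_chords a b F (Defs.reflect a b x).
Proof.
split=> [/above_chords_reflect|/above_chords_reflect].
  by rewrite comp_reflectK.
by rewrite [a + b - _]reflectK.
Qed.

(** This is where a concave majorant touching F at x comes from. *)
Lemma support_line a b F x : a < b -> regular a b F -> a <= x -> x <= b ->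
  above_chords a b F x ->
  exists k, forall y, a <= y -> y <= b -> F y <= F x + k * (y - x).
Proof.
move=> ab.
(* above an end of the interval there is no tangent, but the difference
   quotients are bounded above: near the end by regularity, away from it by the
   boundedness of F *)
have left_end F' : regular a b F' ->
    exists k, forall y, a <= y -> y <= b -> F' y <= F' a + k * (y - a).
  move=> rF; have [_ [K [d [d0 Fa _]]]] := rF.
  have [m [am mb Fm]] := regular_has_max rF (lexx a) (ltW ab) (lexx b).
  have ma : F' a <= F' m by apply: Fm => //; exact: ltW.
  exists (Num.max K ((F' m - F' a) / d)) => y ay yb.
  have [yd|yd] := ltP y (a + d).
    have := Fa y ay yb yd; rewrite ler_norml lerBlDl => /andP[_ H].
    rewrite (le_trans H)// lerD2l ler_wpM2r ?subr_ge0// le_max lexx//.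
  rewrite -lerBlDl (@le_trans _ _ ((F' m - F' a) / d * (y - a)))//.
    rewrite -mulrA (@le_trans _ _ (F' m - F' a))//.
      by rewrite lerD2r; apply: Fm.
    rewrite ler_peMr ?subr_ge0// mulrC ler_pdivlMr//; lra.
  by rewrite ler_wpM2r ?subr_ge0// le_max lexx orbT.
move=> rF ax xb H.
have [->|xa] := eqVneq x a; first exact: left_end.
have [->|xb'] := eqVneq x b.
  have [k Hk] := left_end _ (regular_reflect rF).
  exists (- k) => y ay yb; have := Hk (a + b - y).
  rewrite /= /Defs.reflect; have -> : a + b - (a + b - y) = y by lra.
  have -> : a + b - a = b by lra.
  move=> Hy; have : F y <= F b + k * (a + b - y - a) by apply: Hy; lra.
  lra.
exists (derive1 F x); apply: above_chords_tangent => //; try lra.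
by apply: rF.1; rewrite in_itv /= !lt_neqAle ax xb xb' eq_sym xa.
Qed.

Lemma concave_on_line (A : set R) p k : concave_on A (fun x => p + k * x).
Proof.
move=> t x y _ _; set s : R := t%:num.
suff : - (p + k * (s * x + (1 - s) * y)) <=
    s * - (p + k * x) + (1 - s) * - (p + k * y) by [].
by lra.
Qed.

Lemma concave_on_above_chords a b G x : concave_on `[a, b] G ->
  above_chords a b G x.
Proof.
move=> cG y z ay yx xz zb.
have yz : 0 < z - y by lra.
have t0 : 0 <= (z - x) / (z - y) by rewrite divr_ge0//; lra.
have t1 : (z - x) / (z - y) <= 1 by rewrite ler_pdivrMr// mul1r; lra.
have := cG (Itv01 t0 t1) y z.
have ys : y \in (`[a, b]%classic : set R) by rewrite inE /= in_itv /=; lra.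
have zs : z \in (`[a, b]%classic : set R) by rewrite inE /= in_itv /=; lra.
move=> /(_ ys zs); set t := (z - x) / (z - y) => H.
have {}H : - G (t * y + (1 - t) * z) <= t * - G y + (1 - t) * - G z by [].
have tE : t * (z - y) = z - x by rewrite mulfVK// gt_eqF.
move: H; have -> : t * y + (1 - t) * z = x by lra.
have -> : z - x = t * (z - y) by [].
have -> : x - y = (1 - t) * (z - y) by lra.
nra.
Qed.

(** A concave majorant lies above the chords of F, hence so does their infimum;
conversely a support line is itself a concave majorant. *)
Lemma contact_setP a b F x : a < b -> regular a b F ->
  contact_set a b F x <-> [/\ a <= x, x <= b & above_chords a b F x].
Proof.
move=> ab rF.
pose S x := [set G x | G in [set G : R -> R |
    concave_on `[a, b] G /\ {in `[a, b], forall y, F y <= G y}]].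
have S_line x0 p k : a <= x0 -> x0 <= b ->
    (forall y, a <= y -> y <= b -> F y <= p + k * y) -> S x0 (p + k * x0).
  move=> ax xb H; exists (fun x => p + k * x) => //; split.
    exact: concave_on_line.
  by move=> y; rewrite in_itv /= => /andP[]; apply: H.
have S_lb x0 : a <= x0 -> x0 <= b -> lbound (S x0) (F x0).
  by move=> ax xb _ [G [_ H] <-]; apply: H; rewrite in_itv /= ax.
have S_nonempty x0 : a <= x0 -> x0 <= b -> S x0 !=set0.
  have [m [_ _ H]] := regular_has_max rF (lexx a) (ltW ab) (lexx b).
  move=> ax xb; exists (F m + 0 * x0); apply: S_line => // y ay yb.
  by rewrite mul0r addr0; apply: H.
split.
  move=> [/=]; rewrite in_itv /= => /andP[ax xb] xE; split=> // y z ay yx xz zb.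
  have zy : 0 < z - y by lra.
  rewrite -ler_pdivrMr// -{}xE; apply: lb_le_inf; first exact: S_nonempty.
  move=> _ [G [cG FG] <-]; rewrite ler_pdivrMr//.
  have := concave_on_above_chords (x := x) cG ay yx xz zb.
  apply: le_trans; apply: lerD; apply: ler_wpM2r; rewrite ?subr_ge0;
    by [exact: ltW | apply: FG; rewrite in_itv /=; lra].
move=> [ax xb H]; split; first by rewrite /= in_itv /= ax.
have [k Hk] := support_line ab rF ax xb H.
apply/le_anti/andP; split; last exact: lb_le_inf (S_nonempty x ax xb) (S_lb x ax xb).
have -> : F x = (F x - k * x) + k * x by lra.
apply: ge_inf; first by exists (F x); apply: S_lb.
by apply: S_line => // y ay yb; have := Hk y ay yb; lra.
Qed.

(** The chord that passes strictly over x also passes strictly over the nearby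
points, by continuity of F. *)
Lemma not_above_chords_open a b F x : regular a b F -> a <= x -> x <= b ->
  ~ above_chords a b F x ->
  exists2 d, 0 < d &
    forall y, a <= y -> y <= b -> `|y - x| < d -> ~ above_chords a b F y.
Proof.
move=> rF ax xb /existsNP[y /existsNP[z]].
move=> /not_implyP[ay /not_implyP[yx /not_implyP[xz /not_implyP[zb /negP]]]].
rewrite -ltNge => H.
pose s := (F z - F y) / (z - y).
have yz0 : z - y != 0 by rewrite subr_eq0 gt_eqF// (lt_trans yx).
have sE : F z = F y + s * (z - y) by rewrite mulfVK//; lra.
have {}H : 0 < F y + s * (x - y) - F x.
  have : 0 < (F y + s * (x - y) - F x) * (z - y) by rewrite sE in H; nra.
  by rewrite pmulr_lgt0//; lra.
set eta := (X in 0 < X) in H.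
have [|d d0 Hd] := regular_continuous (e := eta / 2) rF ax xb; first lra.
have s1 : 0 < `|s| + 1 by rewrite ltr_wpDl.
exists (Num.min (Num.min d (eta / 2 / (`|s| + 1))) (Num.min (x - y) (z - x))).
  by rewrite !lt_min d0 !divr_gt0//=; lra.
move=> t at_ tb; rewrite !lt_min => /andP[/andP[td ts] /andP[ty tz]] /(_ y z ay).
have {}ty : y < t by move: ty; rewrite ltr_norml; lra.
have {}tz : t < z by move: tz; rewrite ltr_norml; lra.
move=> /(_ ty tz zb); apply/negP; rewrite -ltNge sE.
have := Hd t at_ tb td; rewrite ltr_norml => /andP[_ H1].
have H2 : s * (x - t) <= eta / 2.
  rewrite (le_trans (ler_norm _))// normrM distrC.
  move: ts; rewrite ltr_pdivlMr// mulrDr mulr1 mulrC => /ltW; apply: le_trans.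
  by rewrite lerDl.
have {}H : F t < F y + s * (t - y) by rewrite /eta in H1 H2; lra.
nra.
Qed.

End Contact.

(** * The gaps between contact points *)

Section Gaps.
Context {R : realType}.
Implicit Types (F G : R -> R) (a b x y z k d e : R) (w v : R * R).

(** The ends of a component interval of the noncontact set. *)
Definition gap a b F w : Prop :=
  [/\ [/\ a <= w.1, w.1 < w.2 & w.2 <= b],
      above_chords a b F w.1, above_chords a b F w.2 &
      forall x, w.1 < x -> x < w.2 -> ~ above_chords a b F x].

Definition chord F w x : R := F w.1 + (x - w.1) * slope F w.1 w.2.

Lemma chord_right F w : w.1 < w.2 -> chord F w w.2 = F w.2.
Proof.
by move=> w12; rewrite /chord /slope mulrC divfK ?subr_eq0 ?gt_eqF// addrC subrK.
Qed.

Lemma chord_left F w : chord F w w.1 = F w.1.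
Proof. by rewrite /chord subrr mul0r addr0. Qed.

Lemma chord_shift F w x y :
  chord F w x = chord F w y + slope F w.1 w.2 * (x - y).
Proof. by rewrite /chord; ring. Qed.

Lemma gap_reflect a b F w : gap a b F w ->
  gap a b (F \o Defs.reflect a b) (Defs.reflect a b w.2, Defs.reflect a b w.1).
Proof.
move=> [[aw w12 wb] H1 H2 H]; split=> /=.
- by rewrite /Defs.reflect; split; lra.
- by apply/above_chords_reflectP; rewrite reflectK.
- by apply/above_chords_reflectP; rewrite reflectK.
- move=> x; rewrite /Defs.reflect => wx xw /above_chords_reflectP; apply: H.
    by rewrite /Defs.reflect; lra.
  by rewrite /Defs.reflect; lra.
Qed.

(** The supremum of the contact points on the left of x is a contact point, since
the other points form an open set. *)
Lemma not_above_chords_left_end a b F x : regular a b F -> a <= x -> x <= b ->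
  ~ above_chords a b F x ->
  exists l, [/\ a <= l, l < x, above_chords a b F l &
    forall y, l < y -> y <= x -> ~ above_chords a b F y].
Proof.
move=> rF ax xb nx.
have Ha : above_chords a b F a by move=> y z ay ya; exfalso; lra.
pose S := [set y | [/\ a <= y, y <= x & above_chords a b F y]].
have Sa : S a by split.
have ubS : has_ubound S by exists x => y [].
have hS : has_sup S by split=> //; exists a.
have al : a <= sup S by exact: ub_le_sup.
have lx : sup S <= x by apply: ge_sup; [exists a | move=> y []].
have Hl : above_chords a b F (sup S).
  apply: contrapT => nl.
  have [d d0 Hd] := not_above_chords_open rF al (le_trans lx xb) nl.
  have [y [ay yx Hy] yl] := sup_adherent d0 hS.
  have yS : y <= sup S by apply: ub_le_sup.
  by apply: (Hd y) => //; [lra | rewrite ltr_norml; lra].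
exists (sup S); split=> //.
  by rewrite lt_neqAle lx andbT; apply/eqP => E; apply: nx; rewrite -E.
move=> y ly yx Hy; suff : y <= sup S by lra.
by apply: ub_le_sup => //; split=> //; lra.
Qed.

Lemma not_above_chords_gap a b F x : regular a b F -> a <= x -> x <= b ->
  ~ above_chords a b F x -> exists w, [/\ gap a b F w, w.1 < x & x < w.2].
Proof.
move=> rF ax xb nx.
have [l [al lx Hl Nl]] := not_above_chords_left_end rF ax xb nx.
have := @not_above_chords_left_end a b _ (Defs.reflect a b x) (regular_reflect rF).
rewrite {1 2}/Defs.reflect => -[||Hr|r [ar rx Hr Nr]]; [lra|lra| |].
  by apply: nx; move/above_chords_reflectP : Hr; rewrite reflectK.
exists (l, Defs.reflect a b r); split=> //=; last first.
  by move: rx; rewrite /Defs.reflect; lra.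
split=> //=.
- by move: rx; rewrite /Defs.reflect; split; lra.
- exact/above_chords_reflectP.
- move=> y ly yr; have [yx|xy] := leP y x; first exact: Nl.
  have := Nr (Defs.reflect a b y); move: yr xy; rewrite /Defs.reflect => yr xy.
  move=> H Hy; apply: H; [lra|lra|].
  by apply/above_chords_reflectP; rewrite reflectK.
Qed.

Lemma gap_disjoint a b F w v x : gap a b F w -> gap a b F v ->
  w.1 < x -> x < w.2 -> v.1 < x -> x < v.2 -> w = v.
Proof.
move=> [[_ w12 _] w1 w2 wN] [[_ v12 _] v1 v2 vN] wx xw vx xv.
rewrite [w]surjective_pairing [v]surjective_pairing; congr pair.
- have [H|H|//] := ltgtP w.1 v.1.
  + by exfalso; apply: (wN v.1) => //; lra.
  + by exfalso; apply: (vN w.1) => //; lra.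
- have [H|H|//] := ltgtP w.2 v.2.
  + by exfalso; apply: (vN w.2) => //; lra.
  + by exfalso; apply: (wN v.2) => //; lra.
Qed.

(** Consider the excess g of F over the chord of the gap.  Outside the gap g <= 0,
because the ends of the gap are contact points of g at level 0.  If g were
nonnegative somewhere inside, it would attain its maximum over [a, b] inside, and
a maximiser is a contact point. *)
Lemma gap_chord a b F w : regular a b F -> gap a b F w ->
  (forall x, a <= x -> x <= b -> F x <= chord F w x) /\
  (forall x, w.1 < x -> x < w.2 -> F x < chord F w x).
Proof.
move=> rF [[aw w12 wb] H1 H2 N].
have E1 := chord_left F w.
have E2 := chord_right F w12.
have chordB := chord_shift F w.
set k := slope F w.1 w.2 in chordB.
pose g x := F x - chord F w x.
have gE x : F x = g x + chord F w x by rewrite /g; lra.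
have g1 : g w.1 = 0 by rewrite /g E1 subrr.
have g2 : g w.2 = 0 by rewrite /g E2 subrr.
have gchords x : above_chords a b F x -> above_chords a b g x.
  move=> H y z ay yx xz zb; have := H y z ay yx xz zb.
  rewrite !gE (chordB x y) (chordB z y); nra.
have chordsg x : above_chords a b g x -> above_chords a b F x.
  move=> H y z ay yx xz zb; have := H y z ay yx xz zb.
  rewrite !gE (chordB x y) (chordB z y); nra.
have outside x : a <= x -> x <= b -> x < w.1 \/ w.2 < x -> g x <= 0.
  move=> ax xb [xw|wx].
  - have := gchords _ H1 x w.2 ax xw w12 wb; rewrite g1 g2 !mul0r addr0.
    by rewrite pmulr_lle0//; lra.
  - have := gchords _ H2 w.1 x aw w12 wx xb; rewrite g1 g2 !mul0r add0r.
    by rewrite pmulr_lle0//; lra.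
have inside x : w.1 < x -> x < w.2 -> g x < 0.
  move=> wx xw.
  have [m [wm mw Hm]] : exists m, [/\ w.1 <= m, m <= w.2 &
      forall y, w.1 <= y -> y <= w.2 -> g y <= g m].
    have [m [wm mw Hm]] := regular_has_max (regular_subl k rF) aw (ltW w12) wb.
    exists m; split=> // y wy yw; have := Hm y wy yw.
    by rewrite /g (chordB y m); lra.
  have gm : 0 <= g m by rewrite -g1; apply: Hm => //; lra.
  rewrite ltNge; apply/negP => gx.
  (* the maximum is attained inside: at m, or at x if it vanishes *)
  have [t [wt tw Ht]] : exists t, [/\ w.1 < t, t < w.2 &
      forall y, w.1 <= y -> y <= w.2 -> g y <= g t].
    have [m0|m0] := leP (g m) 0.
      by exists x; split=> // y wy yw; have := Hm y wy yw; lra.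
    exists m; split=> //; rewrite lt_neqAle ?wm ?mw andbT;
      by apply/eqP => E; rewrite -?E ?g1 ?E ?g2 ltxx in m0.
  have gt : 0 <= g t by rewrite -g1; apply: Ht => //; lra.
  apply: (N t wt tw); apply: chordsg; apply: (@above_chords_of_line _ _ _ _ _ 0).
  move=> y ay yb; rewrite mul0r addr0.
  have [yw|wy] := ltP y w.1; first by rewrite (le_trans _ gt)// outside//; left.
  have [wy2|yw2] := ltP w.2 y; first by rewrite (le_trans _ gt)// outside//; right.
  exact: Ht.
split=> x; last by move=> wx xw; have := inside x wx xw; rewrite subr_lt0.
move=> ax xb; rewrite -subr_le0 -/(g x).
have [xw|wx] := ltP x w.1; first by apply: outside => //; left.
have [wx2|xw2] := ltP w.2 x; first by apply: outside => //; right.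
have [->|xw1] := eqVneq x w.1; first by rewrite g1.
have [->|xw2'] := eqVneq x w.2; first by rewrite g2.
by apply/ltW/inside; rewrite lt_neqAle ?wx ?xw2 ?xw2' 1?eq_sym ?xw1.
Qed.

Lemma gap_bridge a b F w : regular a b F -> gap a b F w -> bridge a b F w.1 w.2.
Proof.
move=> rF gw; have [le lt] := gap_chord rF gw.
have [[aw w12 wb] H1 H2 N] := gw.
have E2 := chord_right F w12.
have chordB := chord_shift F w.
split=> //.
- by move=> z; rewrite in_itv /= => /andP[]; apply: lt.
- move=> aw'; have dF : derivable F w.1 1 by apply: rF.1; rewrite in_itv /=; lra.
  apply/le_anti/andP; split.
  + apply: (derive1_le_right dF (e := b - w.1)); first lra.
    move=> y wy yb; have := le y; rewrite (chordB y w.1) chord_left; apply; lra.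
  + apply: (derive1_ge_left dF (e := w.1 - a)); first lra.
    move=> y wy yb; have := le y; rewrite (chordB y w.1) chord_left; apply; lra.
- move=> wb'; have dF : derivable F w.2 1 by apply: rF.1; rewrite in_itv /=; lra.
  apply/le_anti/andP; split.
  + apply: (derive1_le_right dF (e := b - w.2)); first lra.
    move=> y wy yb; have := le y; rewrite (chordB y w.2) E2; apply; lra.
  + apply: (derive1_ge_left dF (e := w.2 - a)); first lra.
    move=> y wy yb; have := le y; rewrite (chordB y w.2) E2; apply; lra.
Qed.

Lemma bridge_below_chord_gap a b F w : bridge a b F w.1 w.2 ->
  (forall x, a <= x -> x <= b -> F x <= chord F w x) -> gap a b F w.
Proof.
move=> [[aw w12 wb] lt _ _] le.
have E2 := chord_right F w12.
have chordB := chord_shift F w.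
split=> //.
- apply: (@above_chords_of_line _ _ _ _ _ (slope F w.1 w.2)) => y ay yb.
  by rewrite -{1}(chord_left F w) -chordB; apply: le.
- apply: (@above_chords_of_line _ _ _ _ _ (slope F w.1 w.2)) => y ay yb.
  by rewrite -{1}E2 -chordB; apply: le.
- move=> x wx xw /(_ w.1 w.2 aw wx xw wb).
  have := lt x; rewrite in_itv /= wx xw => /(_ isT); rewrite -/(chord F w x).
  rewrite (chordB x w.1) chord_left => Fx.
  have Fw : F w.2 = F w.1 + slope F w.1 w.2 * (w.2 - w.1).
    by rewrite -{1}E2 (chordB w.2 w.1) chord_left.
  rewrite {}Fw; nra.
Qed.

End Gaps.

(** * The first bridge found is a gap *)

Section FirstBridge.
Context {R : realType}.
Implicit Types (F : R -> R) (a b x y z k u t : R) (w v J K L N : R * R)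
  (Ls Ps out : seq (R * R)).

(** Here x may be an end of [u, t], unlike in the tangent property of a single
contact point. *)
Lemma concave_tangent u t F x : derivable F x 1 ->
  (forall y, above_chords u t F y) -> u <= x -> x <= t ->
  forall y, u <= y -> y <= t -> F y <= F x + derive1 F x * (y - x).
Proof.
move=> dF H ux xt y uy yt.
have [yx|xy|<-] := ltgtP y x; last by rewrite subrr mulr0 addr0.
- have yx0 : x - y != 0 by rewrite subr_eq0 gt_eqF.
  pose k := (F x - F y) / (x - y).
  have kE : F x - F y = k * (x - y) by rewrite mulfVK.
  suff : derive1 F x <= k by nra.
  apply: (derive1_le_left dF (e := x - y)); first lra.
  move=> z yz zx; have := H z y x uy; move=> /(_ _ zx xt) H1.
  have {}H1 : F y * (x - z) + F x * (z - y) <= F z * (x - y) by apply: H1; lra.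
  have Fy : F y = F x - k * (x - y) by lra.
  have : 0 <= (F z - (F x + k * (z - x))) * (x - y) by move: H1; rewrite Fy; nra.
  by rewrite pmulr_lge0 ?subr_gt0// subr_ge0.
- have yx0 : y - x != 0 by rewrite subr_eq0 gt_eqF.
  pose k := (F y - F x) / (y - x).
  have kE : F y - F x = k * (y - x) by rewrite mulfVK.
  suff : k <= derive1 F x by nra.
  apply: (derive1_ge_right dF (e := y - x)); first lra.
  move=> z xz zy; have := H z x y ux xz; move=> /(_ _ yt) H1.
  have {}H1 : F x * (y - z) + F y * (z - x) <= F z * (y - x) by apply: H1; lra.
  have Fy : F y = F x + k * (y - x) by lra.
  have : 0 <= (F z - (F x + k * (z - x))) * (y - x) by move: H1; rewrite Fy; nra.
  by rewrite pmulr_lge0 ?subr_gt0// subr_ge0.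
Qed.

Lemma bridge_not_in_concave a b u t F v : bridge a b F v.1 v.2 ->
  (forall y, above_chords u t F y) -> u <= v.1 -> v.2 <= t -> False.
Proof.
move=> [[_ v12 _] lt _ _] H uv vt.
pose m := (v.1 + v.2) / 2.
have vm : v.1 < m by rewrite /m; lra.
have mv : m < v.2 by rewrite /m; lra.
have := lt m; rewrite in_itv /= vm mv => /(_ isT); rewrite -/(chord F v m).
have := H m v.1 v.2 uv vm mv vt.
have E2 := chord_right F v12.
have {}E2 : F v.2 = F v.1 + (v.2 - v.1) * slope F v.1 v.2 by rewrite -{1}E2.
rewrite {1}E2 /chord; nra.
Qed.

Lemma gap_trichotomy a b F v w : gap a b F v -> gap a b F w ->
  [\/ v = w, v.2 <= w.1 | w.2 <= v.1].
Proof.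
move=> gv gw; have [[_ v12 _] _ _ _] := gv; have [[_ w12 _] _ _ _] := gw.
have [vw|wv] := leP v.2 w.1; first by constructor 2.
have [wv'|vw'] := leP w.2 v.1; first by constructor 3.
constructor 1.
pose x := (Num.max v.1 w.1 + Num.min v.2 w.2) / 2.
have [H1 H2 H3 H4] : [/\ v.1 < x, x < v.2, w.1 < x & x < w.2].
  by rewrite /x /Num.max /Num.min; case: ifP => ?; case: ifP => ?; split; lra.
exact: gap_disjoint gv gw H1 H2 H3 H4.
Qed.

(** If the bridge is not a gap, some gap ending in J starts further left, at a
point lying strictly above the line of the bridge.  By minimality of the search
it starts in the same piece as the bridge, and this contradicts concavity there.
The target J stands either for the last of the current pieces or
for the degenerate interval [b, b]; the two hypotheses on gaps say that a gap
ending in J has its start among the candidates, and that a gap around w.2 ends in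
J. *)
Lemma first_bridge_gap a b F Ls J w : regular a b F ->
  {in Ls, forall N, a <= N.1 /\ forall x, above_chords N.1 N.2 F x} ->
  pairwise (fun K N => K.2 <= N.1) Ls ->
  (forall x, above_chords J.1 J.2 F x) ->
  (forall v, gap a b F v -> v.2 \in `[J.1, J.2] ->
     exists2 K, K \in (a, a) :: Ls & v.1 \in `[K.1, K.2]) ->
  (forall v, gap a b F v -> v.1 < w.2 -> w.2 < v.2 -> v.2 \in `[J.1, J.2]) ->
  first_bridge a b F ((a, a) :: Ls) J w -> gap a b F w.
Proof.
move=> rF Lcv Lsort Jcv Jend Jcover [Ls1 [L [Ls2 [LsE Ls1N [wL wJ bw]]]]].
have [[aw w12 wb] lt dw1 dw2] := bw.
have chordB := chord_shift F.
have Ew1 := chord_left F w; have Ew2 := chord_right F w12.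
(* no gap ending in J starts to the left of w.1, strictly above the line of w *)
have minimality v : gap a b F v -> v.2 \in `[J.1, J.2] -> v.1 < w.1 ->
    chord F w v.1 < F v.1 -> False.
  move=> gv vJ vw above.
  have [K Kin vK] := Jend v gv vJ.
  have := Kin; rewrite LsE mem_cat in_cons => /or3P[KLs1|/eqP KL|KLs2].
  - apply: (Ls1N K KLs1 v); split=> //; exact: gap_bridge.
  - have LLs : L \in Ls.
      move: Kin; rewrite -KL in_cons => /predU1P[KE|//]; move: wL vK.
      by rewrite -KL KE !in_itv /=; lra.
    have [_ cvL] := Lcv L LLs.
    have aw' : a < w.1 by have [[? ? ?] _ _ _] := gv; lra.
    have dF : derivable F w.1 1 by apply: rF.1; rewrite in_itv /=; lra.
    move: wL vK; rewrite KL !in_itv /= => /andP[L1w wL2] /andP[L1v vL2].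
    have := concave_tangent dF cvL L1w wL2 L1v vL2.
    by rewrite dw1// -{1}Ew1 -chordB; lra.
  - have : pairwise (fun K N => K.2 <= N.1) ((a, a) :: Ls).
      by rewrite pairwise_cons Lsort andbT; apply/allP => N /Lcv[].
    rewrite LsE pairwise_cat pairwise_cons => /and3P[_ _ /andP[/allP H _]].
    by move: wL vK (H K KLs2); rewrite !in_itv /=; lra.
have [Hw2|Nw2] := pselect (above_chords a b F w.2); last first.
  (* w.2 lies in a gap v, whose line is strictly above that of w on the left
     of w.2 *)
  exfalso.
  have [v [gv vw wv]] := not_above_chords_gap rF (le_trans aw (ltW w12)) wb Nw2.
  have [[av v12 vb] _ _ _] := gv.
  have vJ := Jcover v gv vw wv.
  have [lev ltv] := gap_chord rF gv.
  have Ev1 := chord_left F v; have Ev2 := chord_right F v12.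
  have dF : derivable F w.2 1 by apply: rF.1; rewrite in_itv /=; lra.
  have : F v.2 <= chord F w v.2.
    rewrite (chordB w v.2 w.2) Ew2 -dw2; last lra.
    by move: wJ vJ; rewrite !in_itv /= => /andP[? ?] /andP[? ?];
      apply: concave_tangent.
  have := ltv w.2 vw wv; rewrite -{1}Ew2 -{1}Ev2.
  rewrite (chordB v w.2 v.1) (chordB v v.2 v.1) (chordB w w.2 v.1) (chordB w v.2 v.1).
  move=> H1 H2.
  have H3 : slope F v.1 v.2 < slope F w.1 w.2 by nra.
  have below : chord F w v.1 < F v.1 by rewrite -Ev1; nra.
  have v1w1 : v.1 < w.1.
    rewrite ltNge; apply/negP; rewrite le_eqVlt => /predU1P[E|wv1].
      by move: below; rewrite -E Ew1 ltxx.
    have := lt v.1; rewrite in_itv /= wv1 vw => /(_ isT).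
    by rewrite -/(chord F w v.1); lra.
  exact: (minimality v).
have [w2b|bw2] := ltP w.2 b.
  apply: bridge_below_chord_gap bw _ => x ax xb.
  have dF : derivable F w.2 1 by apply: rF.1; rewrite in_itv /=; lra.
  rewrite (chordB w x w.2) Ew2 -dw2//.
  by apply: above_chords_tangent Hw2 _ _ _ => //; lra.
have {wb bw2} w2b : w.2 = b by apply/le_anti; rewrite wb.
have [Hw1|Nw1] := pselect (above_chords a b F w.1).
  apply: bridge_below_chord_gap bw _ => x ax xb.
  move: aw; rewrite le_eqVlt => /predU1P[aE|aw].
    have [<-|xw1] := eqVneq w.1 x; first by rewrite Ew1.
    have [<-|xw2] := eqVneq w.2 x; first by rewrite Ew2.
    apply/ltW/lt; rewrite in_itv /= !lt_neqAle xw1 eq_sym xw2.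
    by rewrite -aE w2b ax.
  have dF : derivable F w.1 1 by apply: rF.1; rewrite in_itv /=; lra.
  rewrite (chordB w x w.1) Ew1 -dw1//.
  by apply: above_chords_tangent Hw1 _ _ _ => //; lra.
(* w.1 lies in a gap v, which ends at b: otherwise the line of w would lie
   above F, hence above that of v, at v.2, and below it at w.1 and at b *)
exfalso; have w1b : w.1 <= b by rewrite -w2b ltW.
have [v [gv vw wv]] := not_above_chords_gap rF aw w1b Nw1.
have [[av v12 vb] _ _ _] := gv.
have [lev ltv] := gap_chord rF gv.
have Ev1 := chord_left F v; have Ev2 := chord_right F v12.
have := ltv w.1 vw wv; rewrite -{1}Ew1.
rewrite (chordB w w.1 w.2) (chordB v w.1 w.2) => H1.
have := lev w.2; rewrite -{1}Ew2 => /(_ _ _) H2.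
have {}H2 : chord F w w.2 <= chord F v w.2 by apply: H2; lra.
have v2b : v.2 = b.
  apply/le_anti; rewrite vb leNgt; apply/negP => v2b.
  have := lt v.2; rewrite in_itv /= wv w2b v2b => /(_ isT).
  rewrite -w2b -/(chord F w v.2) -{1}Ev2 (chordB v v.2 w.2) (chordB w v.2 w.2); nra.
have vw2 : v.2 = w.2 by rewrite v2b w2b.
apply: (minimality v) => //; first by rewrite vw2.
have E : chord F v w.2 = chord F w w.2 by rewrite Ew2 -vw2 Ev2.
rewrite -Ev1 (chordB v v.1 w.2) (chordB w v.1 w.2) E.
move: H1; rewrite E; nra.
Qed.

End FirstBridge.

(** * The loop outputs the pending gaps *)

Section Loop.
Context {R : realType}.
Implicit Types (F : R -> R) (a b x y z k u t : R) (w v J K L N : R * R)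
  (Ls Ps Qs : seq (R * R)).

(** Both ends of the gap v are still visible to the loop.  The half-open
conditions choose the piece in which F leaves the end towards the inside of the
gap; they are what makes the condition stable under truncation. *)
Definition pending a Ps v : Prop :=
  (exists2 N, N \in Ps & N.1 < v.2 <= N.2) /\
  (v.1 = a \/ exists2 N, N \in Ps & N.1 <= v.1 < N.2).

Definition cleared Ps v : Prop := {in Ps, forall N, N.2 <= v.1}.

(** The invariant of the loop. *)
Definition tracked a b F Ps : Prop :=
  forall v, gap a b F v -> pending a Ps v \/ cleared Ps v.

Definition ordered_pieces a Ps : Prop :=
  {in Ps, forall N, a <= N.1 /\ N.1 < N.2} /\
  pairwise (fun K N => K.2 <= N.1) Ps.

Definition concave_pieces F Ps : Prop :=
  {in Ps, forall N x, above_chords N.1 N.2 F x}.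

Lemma mem_truncate x Ps M : M \in truncate x Ps <->
  exists N, [/\ N \in Ps, N.1 < x & M = (N.1, Num.min N.2 x)].
Proof.
split=> [/mapP[N]|[N [NP Nx ->]]].
  by rewrite mem_filter => /andP[Nx NP ->]; exists N.
by apply/mapP; exists N; rewrite ?mem_filter ?Nx.
Qed.

Lemma above_chords_subset u t u' t' F x : u <= u' -> t' <= t ->
  above_chords u t F x -> above_chords u' t' F x.
Proof. by move=> uu tt H y z uy yx xz zt; apply: H => //; lra. Qed.

Lemma truncate_pieces a F x Ps : ordered_pieces a Ps -> concave_pieces F Ps ->
  ordered_pieces a (truncate x Ps) /\ concave_pieces F (truncate x Ps).
Proof.
move=> [Pin Psort] Pcv; split; first split.
- move=> M /mem_truncate[N [/Pin[aN N12] Nx ->]] /=; split=> //.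
  by rewrite lt_min N12.
- rewrite /truncate pairwise_map.
  apply: sub_pairwise (pairwise_filter _ Psort) => K N /= KN.
  by rewrite ge_min KN.
- move=> M /mem_truncate[N [NP Nx ->]] y /=.
  by apply: above_chords_subset (Pcv N NP y) => //; rewrite ge_min lexx.
Qed.

Lemma pending_truncate a b F x Ps v : gap a b F v -> v.2 <= x ->
  pending a Ps v -> pending a (truncate x Ps) v.
Proof.
move=> [[_ v12 _] _ _ _] vx [[N NP /andP[Nv vN]] left_end]; split.
  exists (N.1, Num.min N.2 x); last by rewrite /= Nv le_min vN vx.
  by apply/mem_truncate; exists N; split=> //; lra.
case: left_end => [->|[K KP /andP[Kv vK]]]; [by left|right].
exists (K.1, Num.min K.2 x); last by rewrite /= Kv lt_min vK; lra.
by apply/mem_truncate; exists K; split=> //; lra.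
Qed.

Lemma truncate_pending a x Ps v :
  pending a (truncate x Ps) v -> v.2 <= x /\ pending a Ps v.
Proof.
move=> [[M /mem_truncate[N [NP Nx ->]]]] /=.
rewrite le_min => /and3P[Nv vN vx] left_end; do 2 split=> //.
  by exists N => //; rewrite Nv.
case: left_end => [->|[K /mem_truncate[L [LP Lx ->]]]] /=; [by left|].
by rewrite lt_min => /and3P[Lv vL _]; right; exists L => //; rewrite Lv.
Qed.

Lemma cleared_truncate x Ps v : cleared Ps v -> cleared (truncate x Ps) v.
Proof.
by move=> H M /mem_truncate[N [NP _ ->]] /=; rewrite ge_min H.
Qed.

Lemma cleared_truncate_le x Ps v : x <= v.1 -> cleared (truncate x Ps) v.
Proof.
by move=> H M /mem_truncate[N [NP _ ->]] /=; rewrite ge_min H orbT.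
Qed.

(** One iteration: J is the piece closest to c1 in a tracked list. *)
Section LastPiece.
Variables (a b : R) (F : R -> R) (Ls : seq (R * R)) (J : R * R).
Hypotheses (rF : regular a b F) (Pin : ordered_pieces a (rcons Ls J))
  (Pcv : concave_pieces F (rcons Ls J)) (Ptr : tracked a b F (rcons Ls J)).

Let JP : J \in rcons Ls J. Proof. by rewrite mem_rcons mem_head. Qed.

Let LsP N : N \in Ls -> N \in rcons Ls J.
Proof. by rewrite mem_rcons in_cons => ->; rewrite orbT. Qed.

Lemma pieces_left_of_last N : N \in Ls -> N.2 <= J.1.
Proof.
have [_] := Pin; rewrite -cats1 pairwise_cat /= allrel1r.
by move=> /andP[/allP H _] /H.
Qed.

Lemma ordered_pieces_belast : ordered_pieces a Ls /\ concave_pieces F Ls.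
Proof.
have [Pb] := Pin; rewrite -cats1 pairwise_cat => /and3P[_ H _].
split; first by split=> // N /LsP/Pb.
by move=> N /LsP/Pcv.
Qed.

Lemma gap_ending_in_last v : gap a b F v -> v.1 < J.2 -> J.1 <= v.2 -> v.2 <= J.2 ->
  v.1 = a \/ exists2 K, K \in Ls & K.1 <= v.1 < K.2.
Proof.
move=> gv vJ Jv v2J; have [_] : pending a (rcons Ls J) v.
  by case: (Ptr gv) => // /(_ J JP); lra.
case=> [|[K]]; [by left|rewrite mem_rcons in_cons => /predU1P[->|KLs] Kv].
  exfalso; move: Kv => /andP[Kv _].
  exact: bridge_not_in_concave (gap_bridge rF gv) (Pcv JP) Kv v2J.
by right; exists K.
Qed.

(** A gap ending beyond the last piece is cleared, so it starts beyond J as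
well. *)
Lemma gap_covering_last v x : gap a b F v -> J.1 <= x -> x <= J.2 ->
  v.1 < x -> x < v.2 -> v.2 \in `[J.1, J.2].
Proof.
move=> gv Jx xJ vx xv; rewrite in_itv /=.
have [] := Ptr gv; last by move=> /(_ J JP); lra.
move=> [[N]]; rewrite mem_rcons in_cons => /predU1P[->|/pieces_left_of_last NJ];
  move=> /andP[Nv vN] _; lra.
Qed.

Lemma first_bridge_to_last_gap w : first_bridge a b F ((a, a) :: Ls) J w ->
  gap a b F w.
Proof.
move=> fw; have [Ls1 [L [Ls2 [_ _ [_ wJ _]]]]] := fw.
have [[Lb Lsort] Lcv] := ordered_pieces_belast.
apply: (first_bridge_gap rF _ Lsort (Pcv JP) _ _ fw).
- by move=> N NLs; split; [case: (Lb N NLs) | exact: Lcv].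
- move=> v gv; rewrite in_itv /= => /andP[Jv vJ].
  have [[_ v12 _] _ _ _] := gv.
  case: (gap_ending_in_last gv _ Jv vJ) => [|->|[K KLs /andP[Kv vK]]]; first lra.
    by exists (a, a); rewrite ?mem_head// in_itv /= lexx.
  by exists K; rewrite ?in_cons ?KLs ?orbT// in_itv /= Kv ltW.
- move=> v gv vw wv; move: wJ; rewrite in_itv /= => /andP[Jw wJ].
  exact: gap_covering_last gv Jw wJ vw wv.
Qed.

(** A pending gap ending in J would be a bridge from one of the candidates. *)
Lemma tracked_no_bridge : no_bridge a b F ((a, a) :: Ls) J ->
  forall v, gap a b F v -> pending a (rcons Ls J) v -> pending a Ls v.
Proof.
move=> noJ v gv [[N]]; have [[_ v12 _] _ _ _] := gv.
rewrite mem_rcons in_cons => /predU1P[->|NLs] /andP[Nv vN] left_end.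
  exfalso; have bv := gap_bridge rF gv.
  case: (gap_ending_in_last gv _ (ltW Nv) vN) => [|va|[K KLs /andP[Kv vK]]]; first lra.
    by apply: (noJ (a, a) (mem_head _ _) v); split=> //;
      rewrite in_itv /= ?va ?lexx// vN ltW.
  apply: (noJ K _ v); first by rewrite in_cons KLs orbT.
  by split=> //; rewrite in_itv /= ?Kv ?vN ltW.
split; first by exists N; rewrite ?Nv.
case: left_end => [->|[K]]; [by left|].
rewrite mem_rcons in_cons => /predU1P[->|KLs] /andP[Kv vK].
  by have := pieces_left_of_last NLs; lra.
by right; exists K; rewrite ?Kv.
Qed.

Lemma tracked_belast : no_bridge a b F ((a, a) :: Ls) J -> tracked a b F Ls.
Proof.
move=> noJ v gv; case: (Ptr gv) => [/(tracked_no_bridge noJ gv)|H]; [by left|right].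
by move=> N /LsP; apply: H.
Qed.

Lemma tracked_truncate w : gap a b F w -> tracked a b F (truncate w.1 (rcons Ls J)).
Proof.
move=> gw v gv; case: (gap_trichotomy gv gw) => [->|vw|wv].
- by right; apply: cleared_truncate_le.
- case: (Ptr gv) => [H|H]; [left|right; exact: cleared_truncate].
  exact: pending_truncate gv vw H.
- right; apply: cleared_truncate_le; have [[_ ? _] _ _ _] := gw; lra.
Qed.

(** No pending gap lies on the right of w: it would lie inside J, where F is
concave. *)
Lemma pending_first_bridge w : first_bridge a b F ((a, a) :: Ls) J w ->
  forall v, gap a b F v -> pending a (rcons Ls J) v <->
    v = w \/ pending a (truncate w.1 (rcons Ls J)) v.
Proof.
move=> fw v gv; have gw := first_bridge_to_last_gap fw.
have [[_ w12 _] _ _ _] := gw.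
have [Ls1 [L [Ls2 [_ _ [_ wJ _]]]]] := fw.
move: wJ; rewrite in_itv /= => /andP[Jw wJ].
split=> [Pv|[->|/truncate_pending[]//]]; last first.
  by case: (Ptr gw) => // /(_ J JP); lra.
case: (gap_trichotomy gv gw) => [->|vw|wv]; [by left|right|exfalso].
  exact: pending_truncate gv vw Pv.
have [[N NP /andP[Nv vN]] _] := Pv.
apply: (bridge_not_in_concave (gap_bridge rF gv) (Pcv JP)); first lra.
rewrite (le_trans vN)//; move: NP; rewrite mem_rcons in_cons => /predU1P[->//|NLs].
by have := pieces_left_of_last NLs; have [/(_ J JP)[_ ?] _] := Pin; lra.
Qed.

End LastPiece.

Lemma left_loop_gaps a b F Ps out : regular a b F ->
  Defs.left_loop a b F Ps out -> ordered_pieces a Ps -> concave_pieces F Ps ->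
  tracked a b F Ps ->
  forall v, v \in out <-> gap a b F v /\ pending a Ps v.
Proof.
move=> rF; elim=> {Ps out} [|Ls J out noJ _ IH|Ls J w out fw _ IH] Pin Pcv Ptr v.
- by split=> // -[_ [[N]]].
- have [Lin Lcv] := ordered_pieces_belast Pin Pcv.
  rewrite (IH Lin Lcv (tracked_belast rF Pin Pcv Ptr noJ)); split=> -[gv Pv].
  + split=> //; have [[N NLs Nv] left_end] := Pv; split.
      by exists N => //; rewrite mem_rcons in_cons NLs orbT.
    case: left_end => [->|[K KLs Kv]]; [by left|right].
    by exists K => //; rewrite mem_rcons in_cons KLs orbT.
  + by split=> //; exact: (tracked_no_bridge rF Pin Pcv Ptr noJ).
- have gw := first_bridge_to_last_gap rF Pin Pcv Ptr fw.
  have [Tin Tcv] := truncate_pieces w.1 Pin Pcv.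
  have {}IH := IH Tin Tcv (tracked_truncate Ptr gw).
  have Pw := pending_first_bridge rF Pin Pcv Ptr fw.
  rewrite in_cons; split=> [/predU1P[->|/IH[gv Pv]]|[gv /(Pw v gv)[->|Pv]]].
  + by split=> //; apply/(Pw w gw); left.
  + by split=> //; apply/(Pw v gv); right.
  + by rewrite eqxx.
  + by apply/orP; right; apply/IH.
Qed.

Lemma no_or_first_bridge a b F Ls J :
  no_bridge a b F Ls J \/ exists w, first_bridge a b F Ls J w.
Proof.
elim: Ls => [|K Ls IH]; first by left.
have [[w Kw]|nK] := pselect (exists w, bridge_between a b F K J w).
  by right; exists w, [::], K, Ls.
case: IH => [noLs|[w [Ls1 [L [Ls2 [-> Ls1N Lw]]]]]].
  left=> L; rewrite in_cons => /predU1P[-> w Kw|/noLs//].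
  by apply: nK; exists w.
right; exists w, (K :: Ls1), L, Ls2; split=> //.
move=> N; rewrite in_cons => /predU1P[-> w' Kw|/Ls1N//].
by apply: nK; exists w'.
Qed.

(** Each iteration discards at least the piece in which the bridge ends, so the
number of pieces decreases. *)
Lemma left_loop_total a b F Ps : ordered_pieces a Ps ->
  exists out, Defs.left_loop a b F Ps out.
Proof.
have [n] := ubnP (size Ps); elim: n Ps => // n IH Ps sz Pin.
case/lastP: Ps => [|Ls J] in sz Pin *; first by exists [::]; constructor.
rewrite size_rcons ltnS in sz.
have [noJ|[w fw]] := no_or_first_bridge a b F ((a, a) :: Ls) J.
  have [out Hout] : exists out, Defs.left_loop a b F Ls out.
    apply: IH => //; have [Pb] := Pin.
    rewrite -cats1 pairwise_cat => /and3P[_ Hs _]; split=> // N NLs.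
    by apply: Pb; rewrite mem_rcons in_cons NLs orbT.
  by exists out; apply: LoopFail.
have [Ls1 [L [Ls2 [LsE _ [wL wJ bw]]]]] := fw.
have [Tin _] : ordered_pieces a (truncate w.1 (rcons Ls J)) /\
    concave_pieces (fun=> 0) (truncate w.1 (rcons Ls J)).
  by apply: truncate_pieces Pin _ => N _ y x z _ _ _ _; rewrite !mul0r addr0.
(* the target piece J starts to the right of w.1 and is discarded *)
have wJ1 : w.1 <= J.1.
  have JP : J \in rcons Ls J by rewrite mem_rcons mem_head.
  have : L \in (a, a) :: Ls by rewrite LsE mem_cat mem_head orbT.
  rewrite in_cons => /predU1P[LE|LLs]; move: wL; rewrite in_itv /=.
    by rewrite LE /=; have [/(_ J JP)[]] := Pin; lra.
  by have := pieces_left_of_last Pin LLs; lra.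
have [out Hout] : exists out, Defs.left_loop a b F (truncate w.1 (rcons Ls J)) out.
  apply: IH => //; rewrite size_map size_filter -cats1 count_cat /=.
  by rewrite ltNge wJ1 /= !addn0; apply: leq_ltn_trans sz; rewrite count_size.
by exists (w :: out); apply: LoopFound Hout.
Qed.

End Loop.

(** * The first and the last maximiser *)

Section Maximizers.
Context {R : realType}.
Implicit Types (F : R -> R) (a b c x y z : R) (v : R * R).

Lemma argmax_setP a b F x : a < b -> regular a b F ->
  argmax_set a b F x <->
  [/\ a <= x, x <= b & forall y, a <= y -> y <= b -> F y <= F x].
Proof.
move=> ab rF.
have [m [am mb Hm]] := regular_has_max rF (lexx a) (ltW ab) (lexx b).
have -> : argmax_set a b F = [set x | x \in `[a, b] /\ F x = F m].
  suff E : max_on a b F = F m by rewrite /argmax_set E.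
  have ubM : ubound [set F x | x in `[a, b]] (F m).
    move=> _ [y /= yab <-]; move: yab; rewrite in_itv /= => /andP[ay yb].
    exact: Hm.
  have mM : [set F x | x in `[a, b]] (F m).
    by exists m => //=; rewrite in_itv /= am.
  apply/le_anti/andP; split; first by apply: ge_sup => //; exists (F m).
  by apply: ub_le_sup => //; exists (F m).
split=> [[/= + ->]|[ax xb Hx]]; first by rewrite in_itv /= => /andP[].
by split; [rewrite /= in_itv /= ax | apply/le_anti; rewrite Hm ?Hx].
Qed.

Lemma argmax_set_reflect a b F x : a < b -> regular a b F ->
  argmax_set a b (F \o Defs.reflect a b) x <->
  argmax_set a b F (Defs.reflect a b x).
Proof.
move=> ab rF; rewrite !argmax_setP//; last exact: regular_reflect.
rewrite /=; split=> -[ax xb H]; (split; [move: ax xb; rewrite /Defs.reflect; lra..|]) => y ay yb.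
  rewrite -(reflectK a b y); apply: H; rewrite /Defs.reflect; lra.
apply: H; rewrite /Defs.reflect; lra.
Qed.

(** The set of maximisers is closed, by continuity of F. *)
Lemma least_maximizer a b F : a < b -> regular a b F ->
  exists c, argmax_set a b F c /\ forall x, argmax_set a b F x -> c <= x.
Proof.
move=> ab rF; have AP x := argmax_setP x ab rF.
have [m [am mb Hm]] := regular_has_max rF (lexx a) (ltW ab) (lexx b).
set A := argmax_set a b F.
have Am : A m by apply/AP.
have lbA : has_lbound A by exists a => x /AP[].
have hA : has_inf A by split=> //; exists m.
have lb x : A x -> inf A <= x by move=> Ax; apply: ge_inf.
have ac : a <= inf A by apply: lb_le_inf; [exists m | move=> x /AP[]].
have cb : inf A <= b by rewrite (le_trans (lb m Am)).
exists (inf A); split=> //; apply/AP; split=> // y ay yb.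
rewrite (le_trans (Hm y ay yb))// leNgt; apply/negP => Hc.
have [|d d0 Hd] := regular_continuous (e := F m - F (inf A)) rF ac cb; first lra.
have [x Ax xd] := inf_adherent d0 hA.
have [ax xb Hx] := (AP x).1 Ax.
have := Hd x ax xb; rewrite ger0_norm ?subr_ge0 ?lb// ltrBlDl => /(_ xd).
by rewrite ltr_norml => /andP[_]; have := Hx m am mb; lra.
Qed.

Lemma cminP a b F : a < b -> regular a b F ->
  argmax_set a b F (cmin a b F) /\
  forall x, argmax_set a b F x -> cmin a b F <= x.
Proof.
move=> ab rF; have [c [Ac lb]] := least_maximizer ab rF.
suff -> : cmin a b F = c by [].
apply/le_anti/andP; split; first by apply: ge_inf => //; exists c.
by apply: lb_le_inf => //; exists c.
Qed.

Lemma cmaxP a b F : a < b -> regular a b F ->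
  argmax_set a b F (cmax a b F) /\
  forall x, argmax_set a b F x -> x <= cmax a b F.
Proof.
move=> ab rF; have [c [Ac lb]] := least_maximizer ab (regular_reflect rF).
suff -> : cmax a b F = Defs.reflect a b c.
  split; first exact/argmax_set_reflect.
  move=> x Ax; have : c <= Defs.reflect a b x.
    by apply: lb; apply/argmax_set_reflect; rewrite // reflectK.
  by rewrite /Defs.reflect; lra.
have ub x : argmax_set a b F x -> x <= Defs.reflect a b c.
  move=> Ax; have : c <= Defs.reflect a b x.
    by apply: lb; apply/argmax_set_reflect; rewrite // reflectK.
  by rewrite /Defs.reflect; lra.
have Arc : argmax_set a b F (Defs.reflect a b c) by exact/argmax_set_reflect.
apply/le_anti/andP; split.
  by apply: ge_sup => //; exists (Defs.reflect a b c).
by apply: ub_le_sup => //; exists (Defs.reflect a b c).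
Qed.

Lemma cmin_reflect a b F : a < b -> regular a b F ->
  cmin a b (F \o Defs.reflect a b) = Defs.reflect a b (cmax a b F).
Proof.
move=> ab rF.
have [A1 lb] := cminP ab (regular_reflect rF).
have [A2 ub] := cmaxP ab rF.
apply/le_anti/andP; split.
  by apply: lb; apply/argmax_set_reflect; rewrite // reflectK.
have /argmax_set_reflect-/(_ ab rF)/ub := A1.
by rewrite /Defs.reflect; lra.
Qed.

Lemma argmax_above_chords a b F x : a < b -> regular a b F ->
  argmax_set a b F x -> above_chords a b F x.
Proof.
move=> ab rF /(argmax_setP x ab rF)[_ _ H].
apply: (@above_chords_of_line _ _ _ _ _ 0) => y ay yb.
by rewrite mul0r addr0; apply: H.
Qed.

Lemma above_chords_not_in_gap a b F v x : gap a b F v -> above_chords a b F x ->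
  v.2 <= x \/ x <= v.1.
Proof.
move=> [_ _ _ N] H; have [|xv] := leP v.2 x; first by left.
by right; rewrite leNgt; apply/negP => vx; apply: (N x).
Qed.

(** The line of the gap majorises F at the first maximiser, where F is larger
than at the start of the gap. *)
Lemma gap_slope_gt0 a b F v : a < b -> regular a b F -> gap a b F v ->
  v.2 <= cmin a b F -> 0 < slope F v.1 v.2.
Proof.
move=> ab rF gv vc; have [[av v12 vb] _ _ _] := gv.
have [A lb] := cminP ab rF; have [ac cb Hc] := (argmax_setP _ ab rF).1 A.
have Fv : F v.1 < F (cmin a b F).
  rewrite ltNge; apply/negP => H.
  suff : cmin a b F <= v.1 by lra.
  apply: lb; apply/(argmax_setP _ ab rF); split=> //; first lra.
  by move=> y ay yb; rewrite (le_trans (Hc y ay yb)).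
have := (gap_chord rF gv).1 _ ac cb.
rewrite (chord_shift F v _ v.1) chord_left => H.
have : 0 < slope F v.1 v.2 * (cmin a b F - v.1) by lra.
by rewrite pmulr_lgt0//; lra.
Qed.

End Maximizers.

(** * Pieces of a partition *)

Section Partitions.
Context {R : realType}.
Implicit Types (a c x y z : R) (s : seq R) (J K : R * R).

Lemma pieces_bounds a c s : itv_partition a c s ->
  forall J, J \in pieces a s ->
    [/\ a <= J.1, J.1 < J.2, J.2 <= c & forall z, z \in s -> ~ (J.1 < z < J.2)].
Proof.
move=> [+ /eqP +]; elim: s a => [|x s IH] a //= /andP[ax xs] lc J.
have [xc sx] : x <= c /\ {in s, forall z, x < z}.
  move: xs lc; rewrite lt_path_sortedE => /andP[/allP sx _] <-; split=> //.
  have := mem_last x s; rewrite in_cons => /predU1P[-> //|/sx/ltW//].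
rewrite in_cons => /predU1P[->|/(IH x xs lc)[xJ J12 Jc Js]] /=.
  split=> // z; rewrite in_cons => /predU1P[->|/sx]; lra.
split=> //; first lra.
by move=> z; rewrite in_cons => /predU1P[->|/Js//]; lra.
Qed.

Lemma pieces_sorted a c s : itv_partition a c s ->
  pairwise (fun J K => J.2 <= K.1) (pieces a s).
Proof.
move=> [+ /eqP +]; elim: s a => [|x s IH] a //= /andP[ax xs] lc.
apply/andP; split; last exact: IH.
apply/allP => K KP /=.
by have [|] := @pieces_bounds x c s _ K KP; first by split=> //; apply/eqP.
Qed.

Lemma pieces_cover_left a c s x : itv_partition a c s -> a < x -> x <= c ->
  exists2 J, J \in pieces a s & J.1 < x <= J.2.
Proof.
move=> [+ /eqP +]; elim: s a => [|y s IH] a /=; first by move=> _ ->; lra.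
move=> /andP[ay ys] lc ax xc; have [xy|yx] := leP x y.
  by exists (a, y); rewrite ?mem_head//= ax.
have [J JP Jx] := IH y ys lc yx xc.
by exists J => //; rewrite in_cons JP orbT.
Qed.

Lemma pieces_cover_right a c s x : itv_partition a c s -> a <= x -> x < c ->
  exists2 J, J \in pieces a s & J.1 <= x < J.2.
Proof.
move=> [+ /eqP +]; elim: s a => [|y s IH] a /=; first by move=> _ ->; lra.
move=> /andP[ay ys] lc ax xc; have [yx|xy] := leP y x; last first.
  by exists (a, y); rewrite ?mem_head//= ax.
have [J JP Jx] := IH y ys lc yx xc.
by exists J => //; rewrite in_cons JP orbT.
Qed.

End Partitions.

(** * The left part outputs the gaps on the left of the first maximiser *)

Section LeftPart.
Context {R : realType}.
Implicit Types (F : R -> R) (a b c x y z : R) (v w J K : R * R)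
  (s nodes : seq R) (out : seq (R * R)).

Lemma strictly_convex_chord J F x y z : strictly_convex_on J F ->
  J.1 <= y -> y < x -> x < z -> z <= J.2 ->
  F x * (z - y) < F y * (z - x) + F z * (x - y).
Proof.
move=> cF Jy yx xz zJ.
have yz : 0 < z - y by lra.
have t0 : 0 < (z - x) / (z - y) by rewrite divr_gt0//; lra.
have t1 : (z - x) / (z - y) < 1 by rewrite ltr_pdivrMr// mul1r; lra.
have := cF y z ((z - x) / (z - y)); rewrite !in_itv /= => /(_ _ _ _ t0 t1).
set t := (z - x) / (z - y) => H.
have {}H : F (t * y + (1 - t) * z) < t * F y + (1 - t) * F z.
  by apply: H; [lra | lra | rewrite lt_eqF//; lra].
have tE : t * (z - y) = z - x by rewrite mulfVK// gt_eqF.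
move: H; have -> : t * y + (1 - t) * z = x by lra.
have -> : z - x = t * (z - y) by [].
have -> : x - y = (1 - t) * (z - y) by lra.
nra.
Qed.

Lemma strictly_concave_above_chords J F x : strictly_concave_on J F ->
  above_chords J.1 J.2 F x.
Proof.
move=> cF y z Jy yx xz zJ.
by have := strictly_convex_chord cF Jy yx xz zJ; lra.
Qed.

Lemma strictly_convex_below_chords J F x : strictly_convex_on J F ->
  above_chords J.1 J.2 (fun y => - F y) x.
Proof.
move=> cF y z Jy yx xz zJ.
by have := strictly_convex_chord cF Jy yx xz zJ; lra.
Qed.

Lemma linear_below_chords J F x : linear_on J F ->
  above_chords J.1 J.2 (fun y => - F y) x.
Proof.
move=> [k [m H]] y z Jy yx xz zJ.
by rewrite !H ?in_itv /=; lra.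
Qed.

(** A convex function stays above its tangents and a nonincreasing one has no
positive derivative.  This identifies the pieces that contain the ends of a gap,
where the gap leaves its line downwards. *)
Lemma piece_below_tangent J F x y : derivable F x 1 -> 0 < derive1 F x ->
  J.1 < J.2 -> J.1 <= x -> x <= J.2 -> J.1 <= y -> y <= J.2 ->
  F y < F x + derive1 F x * (y - x) ->
  [\/ strictly_concave_on J F, linear_on J F | strictly_convex_on J F] ->
  monotone_on J F ->
  strictly_concave_on J F /\ strictly_increasing_on J F.
Proof.
move=> dF F'0 J12 Jx xJ Jy yJ Fy shape mon.
have cF : strictly_concave_on J F.
  suff conv : (forall z, above_chords J.1 J.2 (fun y => - F y) z) -> False.
    case: shape => // H; exfalso; apply: conv => z.
      exact: linear_below_chords.
    exact: strictly_convex_below_chords.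
  have [dN dE] := derivableN1 dF.
  by move=> /concave_tangent-/(_ _ dN Jx xJ y Jy yJ); rewrite dE; lra.
split=> //.
have incr : {in `[J.1, J.2] &, {homo F : x y / x <= y}}.
  case: mon => // decr; exfalso.
  suff : derive1 F x <= 0 by lra.
  have [xJ2|J2x] := ltP x J.2.
    apply: (derive1_le_right dF (e := J.2 - x)); first lra.
    move=> z xz zJ; rewrite mul0r addr0; apply: decr; rewrite ?in_itv /=; lra.
  apply: (derive1_le_left dF (e := x - J.1)); first lra.
  move=> z xz zJ; rewrite mul0r addr0; apply: decr; rewrite ?in_itv /=; lra.
move=> u t; rewrite !in_itv /= => /andP[Ju uJ] /andP[Jt tJ] ut.
have := incr u ((u + t) / 2); have := incr ((u + t) / 2) t.
rewrite !in_itv /= => /(_ _ _ _) H1 /(_ _ _ _) H2.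
have {}H1 : F ((u + t) / 2) <= F t by apply: H1; lra.
have {}H2 : F u <= F ((u + t) / 2) by apply: H2; lra.
have := strictly_convex_chord (x := (u + t) / 2) cF Ju; move=> /(_ t _ _ tJ) H3.
have {}H3 : - F ((u + t) / 2) * (t - u) <
    - F u * (t - (u + t) / 2) + - F t * ((u + t) / 2 - u) by apply: H3; lra.
rewrite lt_neqAle (le_trans H2 H1) andbT; apply/eqP => E.
have E2 : F ((u + t) / 2) = F u by lra.
by move: H3; rewrite E2 -E; lra.
Qed.

Section RefinedPartition.
Variables (a b : R) (F : R -> R) (nodes s : seq R).
Hypotheses (ab : a < b) (rF : regular a b F)
  (rs : refined_partition a b F nodes s).

Let c := cmin a b F.
Let P := concave_increasing_pieces a F s.
Let cb : c <= b. Proof. by have [/(argmax_setP _ ab rF)[]] := cminP ab rF. Qed.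

Lemma refined_ordered : ordered_pieces a P.
Proof.
have [ps _ _ _] := rs; split.
  by move=> J; rewrite mem_filter => /andP[_ /(pieces_bounds ps)[]].
exact: pairwise_filter (pieces_sorted ps).
Qed.

Lemma refined_concave : concave_pieces F P.
Proof.
move=> J; rewrite mem_filter => /andP[/asboolP[cF _] _] x.
exact: strictly_concave_above_chords.
Qed.

Lemma refined_le_cmin J : J \in P -> J.2 <= c.
Proof.
have [ps _ _ _] := rs.
by rewrite mem_filter => /andP[_ /(pieces_bounds ps)[]].
Qed.

(** The piece has to extend to the right of v.1, since it is inside the gap that
F is known to fall below its tangent at v.1. *)
Lemma gap_left_end v : gap a b F v -> v.2 <= c ->
  v.1 = a \/ exists2 J, J \in P & J.1 <= v.1 < J.2.
Proof.
move=> gv vc; have [[av v12 vb] _ _ _] := gv.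
have s0 := gap_slope_gt0 ab rF gv vc.
have [_ lt dv _] := gap_bridge rF gv.
move: av; rewrite le_eqVlt => /predU1P[->|av]; [by left|right].
have [ps _ _ shape] := rs.
have [||J JP /andP[Jv vJ]] := pieces_cover_right (x := v.1) ps; [lra..|].
have [aJ J12 Jc _] := pieces_bounds ps JP.
have [cF mF] := shape J JP.
exists J; last by rewrite Jv.
rewrite mem_filter JP andbT; apply/asboolP.
have dF : derivable F v.1 1 by apply: rF.1; rewrite in_itv /=; lra.
pose y := (v.1 + Num.min v.2 J.2) / 2.
have [vy yv yJ] : [/\ v.1 < y, y < v.2 & y < J.2].
  by rewrite /y /Num.min; case: ifP => ?; split; lra.
apply: (piece_below_tangent (x := v.1) (y := y) dF) => //;
  rewrite ?dv ?ltW ?(le_lt_trans Jv)//.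
by rewrite mulrC; apply: lt; rewrite in_itv /= vy.
Qed.

Lemma gap_pending v : gap a b F v -> v.2 <= c -> v.2 < b -> pending a P v.
Proof.
move=> gv vc vb; split; last exact: gap_left_end.
have [[av v12 _] _ _ _] := gv.
have s0 := gap_slope_gt0 ab rF gv vc.
have [_ lt _ dv] := gap_bridge rF gv.
have [ps _ _ shape] := rs.
have [||J JP /andP[Jv vJ]] := pieces_cover_left (x := v.2) ps; [lra|lra|].
have [aJ J12 Jc _] := pieces_bounds ps JP.
have [cF mF] := shape J JP.
exists J; last by rewrite Jv.
rewrite mem_filter JP andbT; apply/asboolP.
have dF : derivable F v.2 1 by apply: rF.1; rewrite in_itv /=; lra.
pose y := (v.2 + Num.max v.1 J.1) / 2.
have [vy yv yJ] : [/\ v.1 < y, y < v.2 & J.1 < y].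
  by rewrite /y /Num.max; case: ifP => ?; split; lra.
apply: (piece_below_tangent (x := v.2) (y := y) dF) => //;
  rewrite ?dv ?ltW ?(lt_le_trans yv)//.
rewrite -{1}(chord_right F v12) -chord_shift.
by apply: lt; rewrite in_itv /= vy.
Qed.

Lemma pending_le_cmin v : pending a P v -> v.2 <= c.
Proof. by move=> [[J /refined_le_cmin Jc /andP[_ vJ]] _]; lra. Qed.

Lemma gap_cmin v : gap a b F v -> v.2 <= c \/ c <= v.1.
Proof.
move=> gv; apply: above_chords_not_in_gap gv _.
by apply: argmax_above_chords => //; have [] := cminP ab rF.
Qed.

Lemma tracked_below_end :
  (forall v, gap a b F v -> v.2 <= c -> v.2 < b) -> tracked a b F P.
Proof.
move=> noend v gv; case: (gap_cmin gv) => [vc|cv]; [left|right].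
  by apply: gap_pending => //; apply: noend gv vc.
by move=> J /refined_le_cmin; lra.
Qed.

Lemma left_part_below_end out :
  Defs.left_loop a b F P out ->
  (forall v, gap a b F v -> v.2 <= c -> v.2 < b) ->
  forall v, v \in out <-> gap a b F v /\ v.2 <= c.
Proof.
move=> loop noend v.
rewrite (left_loop_gaps rF loop refined_ordered refined_concave
  (tracked_below_end noend)).
split=> -[gv Pv]; split=> //; first exact: pending_le_cmin.
by apply: gap_pending => //; apply: noend.
Qed.

(** The bridge ending at b is a gap, by the same argument as in the loop; the
other gaps lie on its left, and truncation keeps them pending. *)
Lemma left_part_at_end w out : c = b ->
  first_bridge a b F ((a, a) :: P) (b, b) w ->
  Defs.left_loop a b F (truncate w.1 P) out ->
  forall v, v \in w :: out <-> gap a b F v /\ v.2 <= c.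
Proof.
move=> cE fw loop.
have [Ls1 [L [Ls2 [_ _ [_ + _]]]]] := fw.
rewrite in_itv /= => /le_anti wb.
have gw : gap a b F w.
  apply: (first_bridge_gap rF _ refined_ordered.2 _ _ _ fw).
  - by move=> J JP; split; [case: (refined_ordered.1 J JP)|exact: refined_concave].
  - by move=> x y z /= by_ yx xz zb; lra.
  - move=> v gv _; have [[_ _ vb] _ _ _] := gv.
    case: (gap_left_end gv _) => [|->|[K KP /andP[Kv vK]]]; first by rewrite cE.
      by exists (a, a); rewrite ?mem_head// in_itv /= lexx.
    by exists K; rewrite ?in_cons ?KP ?orbT// in_itv /= Kv ltW.
  - by move=> v [[_ _ vb] _ _ _] _; rewrite -wb; lra.
have [[_ w12 _] _ _ _] := gw.
have [Tin Tcv] := truncate_pieces w.1 refined_ordered refined_concave.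
have Tpending v : gap a b F v -> v.2 <= w.1 -> pending a (truncate w.1 P) v.
  move=> gv vw; apply: (pending_truncate gv vw).
  have vb : v.2 < b by rewrite wb; lra.
  by apply: (gap_pending gv _ vb); rewrite cE ltW.
have Ttr : tracked a b F (truncate w.1 P).
  move=> v gv; case: (gap_trichotomy gv gw) => [->|vw|wv].
  - by right; apply: cleared_truncate_le.
  - by left; apply: Tpending.
  - by right; apply: cleared_truncate_le; lra.
move=> v; rewrite in_cons; split.
  case/predU1P => [->|]; first by split=> //; rewrite cE wb.
  move/(left_loop_gaps rF loop Tin Tcv Ttr) => [gv /truncate_pending[vw _]].
  by split=> //; rewrite cE wb; lra.
move=> [gv vc]; case: (gap_trichotomy gv gw) => [->|vw|wv].
- by rewrite eqxx.
- apply/orP; right; apply/(left_loop_gaps rF loop Tin Tcv Ttr).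
  by split=> //; apply: Tpending.
- by exfalso; have [[_ v12 vb] _ _ _] := gv; lra.
Qed.

End RefinedPartition.

Lemma left_part_gaps a b F nodes out : a < b -> regular a b F ->
  left_part a b F nodes out ->
  forall v, v \in out <-> gap a b F v /\ v.2 <= cmin a b F.
Proof.
move=> ab rF; case=> {out}.
- move=> -> v; split=> // -[[[av v12 _] _ _ _]]; lra.
- move=> s out ac notend rs loop.
  apply: (left_part_below_end ab rF rs) => // u [[_ _ ub] _ _ _] uc.
  rewrite lt_neqAle ub andbT; apply/eqP => E; apply: notend.
  have [Amin lb] := cminP ab rF; have [Amax _] := cmaxP ab rF.
  have [_ cb _] := (argmax_setP _ ab rF).1 Amin.
  have [_ cb' _] := (argmax_setP _ ab rF).1 Amax.
  by have := lb _ Amax; split; lra.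
- move=> s out ac [cc cb] rs noJ loop.
  apply: (left_part_below_end ab rF rs) => // u gu uc.
  have [[_ _ ub] _ _ _] := gu.
  rewrite lt_neqAle ub andbT; apply/eqP => E.
  have bu := gap_bridge rF gu.
  case: (gap_left_end ab rF rs gu uc) => [ua|[K KP /andP[Ku uK]]].
    by apply: (noJ (a, a) (mem_head _ _) u); split=> //;
      rewrite in_itv /= ?ua ?E lexx.
  apply: (noJ K _ u); first by rewrite in_cons KP orbT.
  by split=> //; rewrite in_itv /= ?Ku ?E ?lexx// ltW.
- move=> s w out ac [cc cb] rs fw loop.
  by apply: (left_part_at_end ab rF rs) => //; rewrite cc.
Qed.

End LeftPart.

(** * Existence of a refined partition *)

Section RefinedPartitionExists.
Context {R : realType}.
Implicit Types (F : R -> R) (p q : {poly R}) (a b c u v x y z : R)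
  (s t nodes : seq R) (J : R * R).

(** Stated without the order of the nodes, the condition is easy to reflect and
to refine. *)
Definition cubic_between_nodes a b F nodes : Prop := forall x y,
  a <= x -> x < y -> y <= b -> {in nodes, forall z, ~ (x < z < y)} ->
  exists2 p : {poly R}, (size p <= 4)%N & {in `[x, y], F =1 horner p}.

Lemma pieces_right_mem a s J : J \in pieces a s -> J.2 \in s.
Proof.
elim: s a => [|x s IH] a //=; rewrite in_cons => /predU1P[->|/IH].
  exact: mem_head.
by rewrite in_cons => ->; rewrite orbT.
Qed.

Lemma cubic_partition_between a b F s : cubic_partition a b F s ->
  cubic_between_nodes a b F (a :: s).
Proof.
move=> [ps H] x y ax xy yb nos.
have [|J JP /andP[Jx xJ]] := pieces_cover_right (x := x) ps ax; first lra.
have [p p4 Fp] := H J JP; exists p => // z; rewrite in_itv /= => zxy.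
apply: Fp; rewrite in_itv /=.
suff : y <= J.2 by lra.
rewrite leNgt; apply/negP => Jy; apply: (nos J.2); last by rewrite xJ.
by rewrite in_cons (pieces_right_mem JP) orbT.
Qed.

Lemma cubic_between_nodes_reflect a b F nodes : cubic_between_nodes a b F nodes ->
  cubic_between_nodes a b (F \o Defs.reflect a b) (map (Defs.reflect a b) nodes).
Proof.
move=> H x y ax xy yb nonodes.
have [||||p p4 Fp] := H (Defs.reflect a b y) (Defs.reflect a b x);
  rewrite /Defs.reflect; try lra.
  move=> z zn zxy; apply: (nonodes (Defs.reflect a b z)); first exact: map_f.
  by rewrite /Defs.reflect; lra.
exists (p \Po ((a + b)%:P - 'X)).
  have s2 : size ((a + b)%:P - 'X : {poly R}) = 2.
    by rewrite -opprB size_polyN size_XsubC.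
  by rewrite size_comp_poly2.
move=> z; rewrite in_itv /= => zxy; rewrite horner_comp !hornerE.
by apply: Fp; rewrite in_itv /= /Defs.reflect; lra.
Qed.

(** Two applications of the mean value theorem compare the slopes of p on either
side of the intermediate point, a third one on p^`() orders them. *)
Lemma poly_strictly_convex p u v :
  (forall z, u < z < v -> 0 < p^`()^`().[z]) -> strictly_convex_on (u, v) (horner p).
Proof.
move=> H.
suff inc x y (t : R) : u <= x -> x < y -> y <= v -> 0 < t -> t < 1 ->
    p.[t * x + (1 - t) * y] < t * p.[x] + (1 - t) * p.[y].
  move=> x y t /=; rewrite !in_itv /= => /andP[ux xv] /andP[uy yv] xy t0 t1.
  have [xy'|yx|E] := ltgtP x y; [exact: inc| |by rewrite E eqxx in xy].
  rewrite addrC [X in _ < X]addrC; have := inc y x (1 - t) uy yx xv.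
  by rewrite subKr; apply; lra.
move=> ux xy yv t0 t1; set m := _ + _.
have xm : x < m by rewrite /m; nra.
have my : m < y by rewrite /m; nra.
have [c1 + E1] := poly_mvt p xm; rewrite in_itv /= => /andP[xc1 c1m].
have [c2 + E2] := poly_mvt p my; rewrite in_itv /= => /andP[mc2 c2y].
have [d + E3] := poly_mvt p^`() (lt_trans c1m mc2); rewrite in_itv /= => d12.
have := H d; move=> /(_ _) H1.
have {}H1 : 0 < p^`()^`().[d] by apply: H1; lra.
have H2 : p^`().[c1] < p^`().[c2].
  by rewrite -subr_gt0 E3 mulr_gt0// subr_gt0 (lt_trans c1m).
have E4 : m - x = (1 - t) * (y - x) by rewrite /m; ring.
have E5 : y - m = t * (y - x) by rewrite /m; ring.
rewrite E4 in E1; rewrite E5 in E2.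
have : 0 < t * (1 - t) * (y - x) * (p^`().[c2] - p^`().[c1]).
  by rewrite !mulr_gt0//; lra.
nra.
Qed.

Lemma strictly_convex_eq_on J F G : {in `[J.1, J.2], F =1 G} ->
  strictly_convex_on J G -> strictly_convex_on J F.
Proof.
move=> FG cG x y t xJ yJ xy t0 t1; rewrite !FG//; first exact: cG.
by move: xJ yJ; rewrite !in_itv /=; nra.
Qed.

Lemma poly_strictly_concave p u v :
  (forall z, u < z < v -> p^`()^`().[z] < 0) -> strictly_concave_on (u, v) (horner p).
Proof.
move=> H; apply: (@strictly_convex_eq_on _ _ (horner (- p))).
  by move=> z _; rewrite hornerN.
by apply: poly_strictly_convex => z /H; rewrite !derivN hornerN oppr_gt0.
Qed.

Lemma poly_nondecreasing p u v :
  (forall z, u < z < v -> 0 <= p^`().[z]) ->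
  {in `[u, v] &, {homo horner p : x y / x <= y}}.
Proof.
move=> H x y; rewrite !in_itv /= => xuv yuv.
rewrite le_eqVlt => /predU1P[->//|xy].
have [d + E] := poly_mvt p xy; rewrite in_itv /= => dxy.
by rewrite -subr_ge0 E; apply: mulr_ge0; [apply: H; lra | rewrite subr_ge0 ltW].
Qed.

Lemma no_root_sign q u v : (forall z, u < z < v -> ~~ root q z) ->
  (forall z, u < z < v -> 0 < q.[z]) \/ (forall z, u < z < v -> q.[z] < 0).
Proof.
move=> H.
have same x y : u < x < v -> u < y < v -> q.[x] < 0 -> 0 < q.[y] -> False.
  move=> xuv yuv x0 y0; have [xy|yx|E] := ltgtP x y.
  - have [|z zxy] := @poly_ivt _ q x y (ltW xy); first by rewrite !ltW.
    by apply/negP/H; lra.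
  - have [|z zxy] := @poly_ivt _ (- q) y x (ltW yx).
      by rewrite !hornerN oppr_le0 oppr_ge0 !ltW.
    by rewrite rootN; apply/negP/H; lra.
  - by move: x0 y0; rewrite E; lra.
have nz z : u < z < v -> q.[z] != 0 by move=> /H.
have [[x xuv x0]|nneg] := pselect (exists2 x, u < x < v & q.[x] < 0); [right|left].
  move=> z zuv; have := nz z zuv; rewrite neq_lt => /orP[//|z0].
  by exfalso; exact: same xuv zuv x0 z0.
move=> z zuv; have := nz z zuv; rewrite neq_lt => /orP[z0|//].
by exfalso; apply: nneg; exists z.
Qed.

(** The condition that a refined partition imposes on its pieces. *)
Definition uniform_shape F u v : Prop :=
  [\/ strictly_concave_on (u, v) F, linear_on (u, v) F
    | strictly_convex_on (u, v) F] /\ monotone_on (u, v) F.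

Definition shape_change F z : Prop := critical_point F z \/ inflection_point F z.

(** The second derivative of a cubic is affine: a zero of it is simple and hence
a change of sign. *)
Lemma cubic_inflection p F x y z : (size p <= 4)%N ->
  {in `[x, y], F =1 horner p} -> x < z < y -> p^`()^`() != 0 ->
  root p^`()^`() z -> inflection_point F z.
Proof.
move=> p4 Fp /andP[xz zy] p0 /factor_theorem[q qE].
have q0 : q != 0 by apply: contraNneq p0 => q0; rewrite qE q0 mul0r.
have sq : (size q <= 1)%N.
  have : (size p^`()^`() <= 2)%N by rewrite !size_deriv; case: (size p) p4 => [|[|[|[|[]]]]].
  by rewrite qE size_Mmonic ?monicXsubC// size_XsubC addn2 ltnS.
have qc : q = (q`_0)%:P by apply: size1_polyC.
have c0 : q`_0 != 0 by apply: contraNneq q0 => c0; rewrite qc c0.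
have Dp d : p^`()^`().[d] = q`_0 * (d - z) by rewrite qE qc !hornerE coefC.
pose e := Num.min (z - x) (y - z).
have [e0 ex ey] : [/\ 0 < e, x <= z - e & z + e <= y].
  by rewrite /e /Num.min; case: ifP => ?; split; lra.
have FpL : {in `[z - e, z], F =1 horner p}.
  by move=> d; rewrite in_itv /= => dz; apply: Fp; rewrite in_itv /=; lra.
have FpR : {in `[z, z + e], F =1 horner p}.
  by move=> d; rewrite in_itv /= => dz; apply: Fp; rewrite in_itv /=; lra.
have NL : {in `[z - e, z], (fun d => - F d) =1 (fun d => - p.[d])}.
  by move=> d dz; rewrite /= FpL.
have NR : {in `[z, z + e], (fun d => - F d) =1 (fun d => - p.[d])}.
  by move=> d dz; rewrite /= FpR.
exists e => //; have [cpos|cneg|cE] := ltgtP 0 q`_0; last by rewrite -cE eqxx in c0.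
- right; split.
    apply: (strictly_convex_eq_on (J := (z - e, z)) NL).
    by apply: poly_strictly_concave => d dz; rewrite Dp pmulr_rlt0//; lra.
  apply: (strictly_convex_eq_on (J := (z, z + e)) FpR).
  by apply: poly_strictly_convex => d dz; rewrite Dp pmulr_rgt0//; lra.
- left; split.
    apply: (strictly_convex_eq_on (J := (z - e, z)) FpL).
    by apply: poly_strictly_convex => d dz; rewrite Dp nmulr_rgt0//; lra.
  apply: (strictly_convex_eq_on (J := (z, z + e)) NR).
  by apply: poly_strictly_concave => d dz; rewrite Dp nmulr_rlt0//; lra.
Qed.

Lemma poly_critical p F x y z : {in `[x, y], F =1 horner p} -> x < z < y ->
  root p^`() z -> critical_point F z.
Proof.
move=> Fp zxy /rootP Dp; rewrite /critical_point derive1E.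
rewrite (@near_eq_derive _ _ _ F (horner p)); last first.
  near=> d; apply: Fp; apply: subset_itv_oo_cc; near: d.
  by apply: near_in_itvoo; rewrite in_itv.
by rewrite -derive1E -derivE Dp.
Unshelve. all: by end_near. Qed.

Lemma poly_uniform_shape p F u v : u < v -> {in `[u, v], F =1 horner p} ->
  p^`() = 0 \/ (forall z, u < z < v -> ~~ root p^`() z) ->
  p^`()^`() = 0 \/ (forall z, u < z < v -> ~~ root p^`()^`() z) ->
  uniform_shape F u v.
Proof.
move=> uv Fp D1 D2; split; last first.
  have [/poly_nondecreasing H|/poly_nondecreasing H] :
      (forall z, u < z < v -> 0 <= p^`().[z]) \/
      (forall z, u < z < v -> 0 <= (- p)^`().[z]).
    case: D1 => [->|/no_root_sign[H|H]].
    - by left=> z _; rewrite horner0.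
    - by left=> z /H/ltW.
    - by right=> z /H/ltW; rewrite derivN hornerN oppr_ge0.
  - by left=> x y xJ yJ xy; rewrite !Fp//; apply: H.
  - right=> x y xJ yJ xy; rewrite !Fp//.
    by rewrite -lerN2 -!hornerN; apply: H.
case: D2 => [D2|/no_root_sign[H|H]].
- constructor 2.
  have D1c : p^`() = (p^`()`_0)%:P.
    by apply: size1_polyC; have := size_deriv p^`(); rewrite D2 size_poly0; case: size => [|[]].
  set k := p^`()`_0 in D1c.
  exists k, (p.[u] - k * u) => x xJ; rewrite Fp//.
  move: xJ; rewrite in_itv /= le_eqVlt => /andP[/predU1P[<- _|ux xv]]; first by lra.
  have [d _] := poly_mvt p ux; rewrite D1c hornerC; lra.
- by constructor 3; apply: strictly_convex_eq_on (poly_strictly_convex H).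
- constructor 1; apply: strictly_convex_eq_on (poly_strictly_concave H).
  by move=> x xJ; rewrite Fp.
Qed.

Lemma cubic_shape_changes p F x y : x < y -> (size p <= 4)%N ->
  {in `[x, y], F =1 horner p} ->
  exists t, {in t, forall z, x < z < y /\ shape_change F z} /\
    forall u v, x <= u -> u < v -> v <= y -> {in t, forall z, ~ (u < z < v)} ->
      uniform_shape F u v.
Proof.
move=> xy p4 Fp; exists (roots p^`() x y ++ roots p^`()^`() x y); split.
  move=> z; rewrite mem_cat !in_roots in_itv /=.
  case/orP => /and3P[rz zxy p0]; split=> //.
    by left; apply: poly_critical Fp zxy rz.
  by right; apply: cubic_inflection p4 Fp zxy p0 rz.
move=> u v xu uv vy nt; apply: (poly_uniform_shape (p := p)) => //.
- by move=> z; rewrite in_itv /= => zuv; apply: Fp; rewrite in_itv /=; lra.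
- have [->|p0] := eqVneq p^`() 0; [by left|right=> z zuv].
  apply/negP => rz; apply: (nt z) => //.
  by rewrite mem_cat in_roots rz p0 in_itv /= andbT; apply/orP; left; lra.
- have [->|p0] := eqVneq p^`()^`() 0; [by left|right=> z zuv].
  apply/negP => rz; apply: (nt z) => //.
  by rewrite mem_cat orbC in_roots rz p0 in_itv /= andbT; apply/orP; left; lra.
Qed.

(** Split [x, y] at a node inside it and recurse; between nodes F is a cubic
polynomial. *)
Lemma shape_changes a b F nodes x y : cubic_between_nodes a b F nodes ->
  a <= x -> x < y -> y <= b ->
  exists t, {in t, forall z, x < z < y /\ shape_change F z} /\
    forall u v, x <= u -> u < v -> v <= y ->
      {in nodes ++ t, forall z, ~ (u < z < v)} -> uniform_shape F u v.
Proof.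
move=> cF; suff main (l : seq R) : {in nodes, forall z, x < z < y -> z \in l} ->
    a <= x -> x < y -> y <= b ->
    exists t, {in t, forall z, x < z < y /\ shape_change F z} /\
      forall u v, x <= u -> u < v -> v <= y ->
        {in nodes ++ t, forall z, ~ (u < z < v)} -> uniform_shape F u v.
  by apply: (main nodes) => z zn _.
(* l lists the nodes that may lie between x and y *)
elim: l x y => [|z l IH] x y nl ax xy yb.
  have [|p p4 Fp] := cF x y ax xy yb; first by move=> z zn /(nl z zn).
  have [t [tP H]] := cubic_shape_changes xy p4 Fp.
  exists t; split=> // u v xu uv vy nt; apply: H => // z zt.
  by apply: nt; rewrite mem_cat zt orbT.
have [/andP[zn zxy]|zout] := boolP ((z \in nodes) && (x < z < y)); last first.
  apply: IH => // d dn dxy; have := nl d dn dxy.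
  by rewrite in_cons => /predU1P[E|//]; move: zout; rewrite -E dn dxy.
have sub d : d \in nodes -> x < d < y -> d != z -> d \in l.
  by move=> dn dxy dz; have := nl d dn dxy; rewrite in_cons (negbTE dz).
move: zxy => /andP[xz zy].
have [||||t1 [t1P H1]] := IH x z; [|lra..|].
  by move=> d dn dxz; apply: sub; rewrite ?lt_eqF//; lra.
have [||||t2 [t2P H2]] := IH z y; [|lra..|].
  by move=> d dn dzy; apply: sub; rewrite ?gt_eqF//; lra.
exists (t1 ++ t2); split.
  by move=> d; rewrite mem_cat => /orP[/t1P|/t2P] [dxy Hd]; split=> //; lra.
move=> u v xu uv vy nt.
have [vz|zv] := leP v z.
  apply: H1 => // d; rewrite mem_cat => dn; apply: nt.
  by move: dn; rewrite !mem_cat => /orP[]->; rewrite ?orbT.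
have zu : z <= u.
  by rewrite leNgt; apply/negP => uz; apply: (nt z); rewrite ?mem_cat ?zn ?uz.
apply: H2 => // d; rewrite mem_cat => dn; apply: nt.
by move: dn; rewrite !mem_cat => /orP[]->; rewrite ?orbT.
Qed.

Lemma refined_partition_exists a b F nodes : a < cmin a b F -> cmin a b F <= b ->
  cubic_between_nodes a b F nodes -> exists s, refined_partition a b F nodes s.
Proof.
move=> ac cb cF; have [t [tP H]] := shape_changes cF (lexx a) ac cb.
set c := cmin a b F in ac cb tP H *.
pose s0 := sort <=%R (undup [seq z <- nodes ++ t | a < z < c]).
pose s := rcons s0 c.
have s0E z : (z \in s0) = (a < z < c) && (z \in nodes ++ t).
  by rewrite mem_sort mem_undup mem_filter.
have sE z : (z \in s) = (z == c) || (a < z < c) && (z \in nodes ++ t).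
  by rewrite mem_rcons in_cons s0E.
have ps : itv_partition a c s.
  split; last by rewrite last_rcons.
  rewrite rcons_path lt_path_sortedE sort_lt_sorted undup_uniq andbT.
  apply/andP; split; first by apply/allP => z; rewrite s0E => /andP[/andP[]].
  have := mem_last a s0; rewrite in_cons s0E.
  by move=> /predU1P[->|/andP[/andP[]]].
exists s; split=> //.
- by move=> z zn az zc; rewrite sE mem_cat zn az zc orbT.
- move=> z; rewrite sE mem_cat => /orP[/eqP->|/andP[_ /orP[zn|/tP[_ [Hz|Hz]]]]].
  + by constructor 1.
  + by constructor 2.
  + by constructor 3.
  + by constructor 4.
- move=> J JP; have [aJ J12 Jc nos] := pieces_bounds ps JP.
  rewrite [J]surjective_pairing; apply: (H J.1 J.2) => // z zn zJ.
  by apply: (nos z _ zJ); rewrite sE zn andbT; apply/orP; right; lra.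
Qed.

End RefinedPartitionExists.

(** * Components of the noncontact set *)

Section Components.
Context {R : realType}.
Implicit Types (F : R -> R) (A X : set R) (a b x y z : R) (v w : R * R).

Lemma connected_component_itv A x y z : x < y -> y < z ->
  `]x, z[%classic `<=` A -> ~ A x -> ~ A z ->
  connected_component A y = `]x, z[%classic.
Proof.
move=> xy yz sub nx nz; apply/seteqP; split; last first.
  apply: connected_component_max => //; first by rewrite /= in_itv /= xy.
  exact/connected_intervalP/interval_is_interval.
have /connected_intervalP itvC := @component_connected _ A y.
have CA := @connected_component_sub _ A y.
have Cy : connected_component A y y.
  by apply: connected_component_refl; apply: sub; rewrite /= in_itv /= xy.
move=> t Ct; rewrite /= in_itv /=; apply/andP; split; rewrite ltNge.
  apply/negP => tx; apply: nx; apply: CA; apply: (itvC _ _ Ct Cy).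
  by rewrite tx ltW.
apply/negP => zt; apply: nz; apply: CA; apply: (itvC _ _ Cy Ct).
by rewrite zt ltW.
Qed.

(** The condition P selects the gaps by position: those on the left of the first
maximiser, between the two extreme maximisers, or on the right. *)
Definition gap_itvs a b F (P : R * R -> Prop) : set (set R) :=
  [set X | exists v, [/\ gap a b F v, P v & X = `]v.1, v.2[%classic]].

(** Contact points are never inside a gap, so between the contact points u and t
the components of the set of noncontact points are whole gaps. *)
Lemma components_gaps a b F (A : set R) u t : regular a b F ->
  a <= u -> t <= b -> above_chords a b F u -> above_chords a b F t ->
  (forall x, A x <-> [/\ u <= x, x <= t & ~ above_chords a b F x]) ->
  components A = gap_itvs a b F (fun v => u <= v.1 /\ v.2 <= t).
Proof.
move=> rF au tb Hu Ht AP.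
have comp v x : gap a b F v -> u <= v.1 -> v.2 <= t -> v.1 < x -> x < v.2 ->
    connected_component A x = `]v.1, v.2[%classic.
  move=> [_ H1 H2 N] uv vt vx xv; apply: connected_component_itv => //.
  - move=> y; rewrite /= in_itv /= => /andP[vy yv].
    by apply/AP; split; [lra | lra | exact: N].
  - by move=> /AP[].
  - by move=> /AP[].
apply/seteqP; split=> X.
  move=> [x /AP[ux xt Nx] <-].
  have [v [gv vx xv]] := not_above_chords_gap rF (le_trans au ux) (le_trans xt tb) Nx.
  have uv : u <= v.1 by case: (above_chords_not_in_gap gv Hu) => //; lra.
  have vt : v.2 <= t by case: (above_chords_not_in_gap gv Ht) => //; lra.
  by exists v; split=> //; apply: comp.
move=> [v [gv [uv vt] ->]]; have [[_ v12 _] _ _ N] := gv.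
have vm : v.1 < (v.1 + v.2) / 2 by lra.
have mv : (v.1 + v.2) / 2 < v.2 by lra.
exists ((v.1 + v.2) / 2); last exact: comp.
by apply/AP; split; [lra | lra | exact: N].
Qed.

Lemma noncontact_components a b F : a < b -> regular a b F ->
  components (noncontact_set a b F) = gap_itvs a b F (fun=> True).
Proof.
move=> ab rF; rewrite (@components_gaps a b F _ a b)//.
- apply/seteqP; split=> X [v [gv _ ->]]; exists v; split=> //.
  by have [[? ? ?] _ _ _] := gv.
- by move=> y z ay ya; exfalso; lra.
- by move=> y z _ _ bz zb; exfalso; lra.
- move=> x; split.
    move=> [/=]; rewrite in_itv /= => /andP[ax xb] Nx; split=> // Hx.
    by apply: Nx; apply/contact_setP.
  move=> [ax xb Nx]; split; first by rewrite /= in_itv /= ax.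
  by move=> /(contact_setP x ab rF)[].
Qed.

(** Between two maximisers a contact point is at least as high as the horizontal
chord joining them, hence is a maximiser. *)
Lemma middle_components a b F : a < b -> regular a b F ->
  components (`[cmin a b F, cmax a b F] `\` argmax_set a b F) =
  gap_itvs a b F (fun v => cmin a b F <= v.1 /\ v.2 <= cmax a b F).
Proof.
move=> ab rF.
have [A1 _] := cminP ab rF; have [A2 _] := cmaxP ab rF.
have [ac1 c1b M1] := (argmax_setP _ ab rF).1 A1.
have [ac2 c2b M2] := (argmax_setP _ ab rF).1 A2.
apply: components_gaps => //; [exact: argmax_above_chords..|].
move=> x; split.
  move=> [/=]; rewrite in_itv /= => /andP[cx xc] Nx; split=> // Hx; apply: Nx.
  have [->//|xc1] := eqVneq x (cmin a b F).
  have [->//|xc2] := eqVneq x (cmax a b F).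
  have {}cx : cmin a b F < x by rewrite lt_neqAle eq_sym xc1.
  have {}xc : x < cmax a b F by rewrite lt_neqAle xc2.
  have := Hx _ _ ac1 cx xc c2b.
  have -> : F (cmax a b F) = F (cmin a b F) by apply/le_anti; rewrite M1 ?M2.
  move=> H; have {}H : F (cmin a b F) <= F x by nra.
  apply/(argmax_setP _ ab rF); split; [lra | lra |].
  by move=> y ay yb; rewrite (le_trans (M1 y ay yb)).
move=> [cx xc Nx]; split; first by rewrite /= in_itv /= cx.
by move=> /(argmax_above_chords ab rF).
Qed.

Lemma gap_position a b F v : a < b -> regular a b F -> gap a b F v ->
  [\/ v.2 <= cmin a b F, cmin a b F <= v.1 /\ v.2 <= cmax a b F
    | cmax a b F <= v.1].
Proof.
move=> ab rF gv.
have H1 := argmax_above_chords ab rF (cminP ab rF).1.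
have H2 := argmax_above_chords ab rF (cmaxP ab rF).1.
case: (above_chords_not_in_gap gv H1) => [|c1v]; first by constructor 1.
by case: (above_chords_not_in_gap gv H2) => [vc2|]; [constructor 2|constructor 3].
Qed.

Lemma algorithm_output_components a b F s out : a < b -> regular a b F ->
  algorithm_output a b F s out -> out = components (noncontact_set a b F).
Proof.
move=> ab rF [outl [outr [left_out right_out ->]]].
have outlP := left_part_gaps ab rF left_out.
have outrP := left_part_gaps ab (regular_reflect rF) right_out.
rewrite cmin_reflect// in outrP.
rewrite middle_components// noncontact_components//.
apply/seteqP; split=> X.
  move=> [[[v [gv _ ->]]|[v /outlP[gv _] <-]]|[v]]; [by exists v | by exists v |].
  move=> /mapP[w /outrP[gw _] ->] <-.
  exists (Defs.reflect a b w.2, Defs.reflect a b w.1); split=> //.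
  by rewrite -(comp_reflectK a b F); apply: gap_reflect.
move=> [v [gv _ ->]]; case: (gap_position ab rF gv) => [vc|vc|cv].
- by left; right; exists v => //; apply/outlP.
- by left; left; exists v.
- right; exists v => //; apply/mapP.
  exists (Defs.reflect a b v.2, Defs.reflect a b v.1).
    apply/outrP; split; first exact: gap_reflect.
    by rewrite /= /Defs.reflect; lra.
  by rewrite /= !reflectK -surjective_pairing.
Qed.

Lemma left_part_total a b F nodes : a < b -> regular a b F ->
  cubic_between_nodes a b F nodes -> exists out, left_part a b F nodes out.
Proof.
move=> ab rF cF.
have [Amin _] := cminP ab rF.
have [ac cb _] := (argmax_setP _ ab rF).1 Amin.
move: ac; rewrite le_eqVlt => /predU1P[ac|ac].
  by exists [::]; apply: LeftNone.
have [s rs] := refined_partition_exists ac cb cF.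
have Pin := refined_ordered rs.
have [atend|notend] := pselect (cmin a b F = cmax a b F /\ cmax a b F = b); last first.
  have [out loop] := left_loop_total b F Pin.
  by exists out; apply: LeftPlain rs loop.
have [noJ|[w fw]] :=
  no_or_first_bridge a b F ((a, a) :: concave_increasing_pieces a F s) (b, b).
  have [out loop] := left_loop_total b F Pin.
  by exists out; apply: LeftEndFail rs noJ loop.
have [Tin _] := truncate_pieces w.1 Pin (@refined_concave R a F s).
have [out loop] := left_loop_total b F Tin.
by exists (w :: out); apply: LeftEndFound rs fw loop.
Qed.

End Components.

Theorem theorem10 (R : realType) (a b : R) (F : R -> R) (s : seq R) :
  a < b ->
  differentiable_on_itv a b F ->
  cubic_partition a b F s ->
  (exists out : set (set R), algorithm_output a b F s out) /\
  (forall out : set (set R), algorithm_output a b F s out ->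
     out = components (noncontact_set a b F)).
Proof.
move=> ab /differentiable_on_itv_regular rF /cubic_partition_between cF.
split; last by move=> out; apply: algorithm_output_components.
have [outl left_out] := left_part_total ab rF cF.
have [outr right_out] :=
  left_part_total ab (regular_reflect rF) (cubic_between_nodes_reflect cF).
by eexists; exists outl, outr.
Qed.
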